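(* Let $b^{\mathrm L},b^{\mathrm R}\in[0,1]$, let $\mathbf C=[c_{xy}]_{x,y\in\{1,2\}}$ be a $2\times 2$ matrix with non-negative entries, and let $G_n$ be the random bipartite compatibility graph with parameters $(b^{\mathrm L},b^{\mathrm R},\mathbf C)$ on $n$ supply and $n$ demand nodes. Let $\mathbf p=(p_1,p_2)=(1-b^{\mathrm L},b^{\mathrm L})$, $\mathbf q=(q_1,q_2)=(1-b^{\mathrm R},b^{\mathrm R})$, and $M_y=\sum_{x=1}^2 c_{xy}p_x$ for $y\in\{1,2\}$. Then, as $n\to\infty$, $$\frac{M_\star(G_n)}{n}\;\longrightarrow\;1-\max_{t_1,t_2\in[0,1]}F(t_1,t_2)\quad\text{in probability},$$ where $$F(t_1,t_2)=\sum_{x=1}^{2}p_x\exp\Big(-\sum_{y=1}^{2}c_{xy}\,q_y\,e^{-M_yt_y}\Big)+\sum_{y=1}^{2}q_y\,e^{-M_yt_y}(1+M_yt_y)-1 .$$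
   Context: Random compatibility graph $G_n$ with parameters $(b^{\mathrm L},b^{\mathrm R},\mathbf C)$: a bipartite graph with $n$ supply nodes and $n$ demand nodes. Independently over nodes, each supply node is of type 2 (flexible) with probability $b^{\mathrm L}$ and of type 1 (regular) otherwise, and each demand node is of type 2 with probability $b^{\mathrm R}$ and of type 1 otherwise. Conditional on all types, edges form independently: a supply node of type $x$ and a demand node of type $y$ are connected with probability $c_{xy}/n$ (with $n$ large enough that all these numbers are at most 1). $M_\star(G)$ denotes the size (number of edges) of a maximum matching in the graph $G$. *)

(* Defs.v *)
From mathcomp Require Import all_boot all_order all_algebra.
From mathcomp Require Import all_classical all_reals all_analysis.
Set Implicit Arguments.
Unset Strict Implicit.
Unset Printing Implicit Defensive.
Import Order.TTheory GRing.Theory Num.Theory.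
Import numFieldNormedType.Exports.
Local Open Scope classical_set_scope.
Local Open Scope ring_scope.

(* A node type is an element of 'I_2: 0 is regular ("type 1"), 1 is flexible
   ("type 2"). The matrix of connection intensities is indexed accordingly. *)
Definition node_types (n : nat) : finType := {ffun 'I_n -> 'I_2}.

(* (i, j) is the potential edge between supply node i and demand node j. *)
Definition bip_graph (n : nat) : finType := {set 'I_n * 'I_n}.

Definition is_matching n (E M : {set 'I_n * 'I_n}) : bool :=
  (M \subset E) &&
  [forall e in M, forall f in M, (e != f) ==> (e.1 != f.1) && (e.2 != f.2)].

Definition max_matching n (E : bip_graph n) : nat :=
  \max_(M : {set 'I_n * 'I_n} | is_matching E M) #|M|.

Definition type_prob (R : realType) (b : R) (x : 'I_2) : R :=
  if x == ord0 then 1 - b else b.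

Definition types_law (R : realType) (bL bR : R) n (u v : node_types n) : R :=
  (\prod_(i < n) type_prob bL (u i)) * (\prod_(j < n) type_prob bR (v j)).

Definition edges_law (R : realType) (C : 'M[R]_2) n (u v : node_types n)
    (E : bip_graph n) : R :=
  \prod_(i < n) \prod_(j < n)
    (if (i, j) \in E then C (u i) (v j) / n%:R else 1 - C (u i) (v j) / n%:R).

(* The supply types U, the demand types V and the edge set G, defined on a
   common probability space, form a random compatibility graph: independent
   types, and edges independent given the types. The values are finite, so this
   is prescribed atom by atom. *)
Definition is_compatibility_graph (R : realType) (bL bR : R) (C : 'M[R]_2)
    n d (T : measurableType d) (P : probability T R)
    (U V : T -> node_types n) (G : T -> bip_graph n) : Prop :=
  forall u v E,
    let A := [set w | [/\ U w = u, V w = v & G w = E]] in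
    measurable A /\ P A = (types_law bL bR u v * edges_law C u v E)%:E.

(* Each X n lives on its own probability space. *)
Definition cvg_in_probability_to (R : realType) (d : nat -> measure_display)
    (T : forall n, measurableType (d n)) (P : forall n, probability (T n) R)
    (X : forall n, T n -> R) (l : R) : Prop :=
  forall eps : R, 0 < eps ->
    (fun n => P n [set w | eps < `|X n w - l|]) @ \oo --> 0%E.

Definition demand_mean (R : realType) (bL : R) (C : 'M[R]_2) (y : 'I_2) : R :=
  \sum_(x < 2) C x y * type_prob bL x.

Definition matching_F (R : realType) (bL bR : R) (C : 'M[R]_2)
    (t : 'I_2 -> R) : R :=
  let p := type_prob bL in
  let q := type_prob bR in
  let M := demand_mean bL C in
  \sum_(x < 2) p x * expR (- \sum_(y < 2) C x y * q y * expR (- (M y * t y)))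
  + \sum_(y < 2) q y * expR (- (M y * t y)) * (1 + M y * t y) - 1.

Definition is_maximum (R : realType) (A : set R) (m : R) : Prop :=
  A m /\ ubound A m.

(* Main.v *)
(* Fix the supply types, so that the demands are independent random sets of
   supplies.  By Konig's theorem the matching number of a list H of demands is
   the minimum over T of |T| + #{N in H : N not inside T}.  The largest minimiser
   T has as complement the set S(H) of supplies missed by some maximum matching:
   a new demand N raises the matching number iff N meets S(H), and S(H) shrinks
   as demands are added.  Write tau_y(S) for the mean number of neighbours in S
   of a new demand of type y.

   Upper bound, for every t: a demand raises the matching number with
   probability about 1 - exp(-tau_y(S(H))), which lies below the tangent at
   tau_y = M_y t_y, and the slope of the tangent is the effect of a demand having
   a single random neighbour.  Replacing the demands one at a time by such
   leaves gives the bound 1 - F(t).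

   Lower bound: the matching number is n - |S(H)| + #{N in H : N meets S(H)}.
   Since |S(H)| is monotone in the number of demands, that number can be chosen,
   by changing it negligibly, so that |S(H)| hardly moves when a bounded number
   of demands is removed.  Then the probabilities that a supply is in S(H) and
   that a demand meets S(H) are computed from the graph without it, as if
   S(H) were independent of it; this gives E[1 - F(t(S(H)))] >= 1 - max F.

   Bounded differences give the concentration. *)
Require Import Defs.
From mathcomp Require Import all_boot all_order all_algebra.
From mathcomp Require Import all_classical all_reals all_analysis.
From mathcomp Require Import fintype finset zify ring lra.
Import Order.TTheory GRing.Theory Num.Theory.
Import numFieldNormedType.Exports.
Set Implicit Arguments.
Unset Strict Implicit.
Unset Printing Implicit Defensive.

(** * Vertex covers, rank and the avoidable set of a list of demands *)

Section TransversalRank.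
Variable I : finType.
Implicit Types (H : seq {set I}) (N T : {set I}) (i : I).

(** This is the size of the smallest vertex cover whose supply part is [T]: a demand with a
    neighbour outside [T] has to be in the cover itself. *)
Definition cover_cost H T : nat := #|T| + count (fun N => ~~ (N \subset T)) H.

(** The min-max formula for the rank of the transversal matroid presented by [H], hence the name. *)
Definition rank H : nat := cover_cost H [arg min_(T < setT) cover_cost H T].

Definition hull H : {set I} :=
  [arg max_(T > [arg min_(T < setT) cover_cost H T]
            | cover_cost H T == rank H) #|T|].

Definition avoidable H : {set I} := ~: hull H.

Lemma rank_le_cover H T : rank H <= cover_cost H T.
Proof. by rewrite /rank; case: arg_minnP => // T0 _; apply. Qed.

Lemma cover_cost_hull H : cover_cost H (hull H) = rank H.
Proof. by rewrite /hull; case: arg_maxnP => [|T /eqP]. Qed.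

Lemma cover_cost_cons N H T :
  cover_cost (N :: H) T = cover_cost H T + ~~ (N \subset T).
Proof. by rewrite /cover_cost /= [X in _ + X]addnC addnA. Qed.

(** Cardinality is modular, and the indicator of [~~ (N \subset T)] is submodular in [T] for every
    [N]. Minimisers are therefore closed under union. *)
Lemma cover_cost_submod H A B :
  cover_cost H (A :|: B) + cover_cost H (A :&: B)
    <= cover_cost H A + cover_cost H B.
Proof.
elim: H => [|N H IH]; first by rewrite /cover_cost /= !addn0 cardsUI.
rewrite !cover_cost_cons subsetI.
have : (N \subset A) -> N \subset A :|: B by move/subset_trans; apply; exact: subsetUl.
have : (N \subset B) -> N \subset A :|: B by move/subset_trans; apply; exact: subsetUr.
by case: (N \subset A) (N \subset B) (N \subset _) => [] [] []; lia.
Qed.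

(** The union of [T] and [hull H] is again a minimiser, by submodularity, and [hull H] has the
    largest cardinality among minimisers. *)
Lemma sub_hull H T : cover_cost H T = rank H -> T \subset hull H.
Proof.
move=> hT.
have hU : cover_cost H (T :|: hull H) = rank H.
  apply/eqP; rewrite eqn_leq rank_le_cover andbT.
  have := cover_cost_submod H T (hull H); rewrite hT cover_cost_hull.
  by have := rank_le_cover H (T :&: hull H); lia.
have hm : #|T :|: hull H| <= #|hull H|.
  rewrite {2}/hull; case: arg_maxnP => [|T' _ hT']; first exact: eqxx.
  by apply: hT'; rewrite hU.
have hs : hull H \subset T :|: hull H by exact: subsetUr.
have /eqP -> : hull H == T :|: hull H by rewrite eqEcard hs hm.
exact: subsetUl.
Qed.

Lemma rank_attained H r : (forall T, r <= cover_cost H T) ->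
  (exists T, cover_cost H T = r) -> rank H = r.
Proof.
move=> hr [T hT]; apply/eqP; rewrite eqn_leq -{1}hT rank_le_cover.
by rewrite -cover_cost_hull hr.
Qed.

(** If [N] lies inside [hull H], this minimiser keeps its cost. Otherwise [sub_hull] shows that no
    minimiser contains [N], so each of them costs one more, and any other set was already above the
    minimum. *)
Lemma rank_cons N H : rank (N :: H) = rank H + ~~ (N \subset hull H).
Proof.
case: (boolP (N \subset hull H)) => hN.
  rewrite addn0; apply: rank_attained => [T|].
    by rewrite cover_cost_cons (leq_trans (rank_le_cover H T)) ?leq_addr.
  by exists (hull H); rewrite cover_cost_cons hN addn0 cover_cost_hull.
rewrite addn1; apply: rank_attained => [T|]; last first.
  by exists (hull H); rewrite cover_cost_cons hN addn1 cover_cost_hull.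
rewrite cover_cost_cons; have := rank_le_cover H T.
rewrite leq_eqVlt => /orP[/eqP hT|]; last by lia.
have : ~~ (N \subset T).
  by apply: contra hN => /subset_trans; apply; apply: sub_hull.
by move=> ->; lia.
Qed.

Lemma hull_cons N H : hull H \subset hull (N :: H).
Proof.
apply: sub_hull; rewrite cover_cost_cons cover_cost_hull rank_cons.
by [].
Qed.

Lemma avoidable_cons N H : avoidable (N :: H) \subset avoidable H.
Proof. by rewrite /avoidable setCS hull_cons. Qed.

Lemma eq_cover_cost H H' : cover_cost H =1 cover_cost H' ->
  rank H = rank H' /\ avoidable H = avoidable H'.
Proof.
move=> eqH.
have hr : rank H = rank H'.
  apply: rank_attained => [T|]; first by rewrite eqH rank_le_cover.
  by exists (hull H'); rewrite eqH cover_cost_hull.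
split=> //; congr (~: _); apply/eqP; rewrite eqEsubset.
by rewrite !sub_hull // ?eqH ?cover_cost_hull -?eqH ?cover_cost_hull.
Qed.

Lemma perm_cover_cost H H' : perm_eq H H' -> cover_cost H =1 cover_cost H'.
Proof. by move=> /permP hp T; rewrite /cover_cost hp. Qed.

Lemma perm_rank H H' : perm_eq H H' -> rank H = rank H'.
Proof. by move/perm_cover_cost/eq_cover_cost => []. Qed.

Lemma perm_avoidable H H' : perm_eq H H' -> avoidable H = avoidable H'.
Proof. by move/perm_cover_cost/eq_cover_cost => []. Qed.

Lemma avoidable_cat H H' : avoidable (H ++ H') \subset avoidable H'.
Proof.
elim: H => [|N H IH] //=; exact: subset_trans (avoidable_cons _ _) IH.
Qed.

Lemma disjoint_avoidable N H : (N :&: avoidable H == set0) = (N \subset hull H).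
Proof. by rewrite /avoidable -setDE setD_eq0. Qed.

Lemma rank_cons_avoidable N H :
  rank (N :: H) = rank H + (N :&: avoidable H != set0).
Proof. by rewrite rank_cons disjoint_avoidable. Qed.

Lemma rank_hullE H :
  rank H = #|hull H| + count (fun N => N :&: avoidable H != set0) H.
Proof.
rewrite -[LHS]cover_cost_hull /cover_cost; congr (_ + _).
by apply: eq_count => N; rewrite disjoint_avoidable.
Qed.

(* The supply [i] is saturated as soon as a demand meets [avoidable H] in [i]
   alone, so this demand acts as if [i] were its only neighbour. *)
Lemma single_hit N H i : N :&: avoidable H = [set i] ->
  avoidable (N :: H) \subset avoidable ([set i] :: H) /\ i \notin avoidable (N :: H).
Proof.
move=> hN.
have hi : i \notin hull H.
  by have := set11 i; rewrite -hN !inE => /andP[].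
have hN' : ~~ (N \subset hull H).
  by rewrite -disjoint_avoidable hN; apply/set0Pn; exists i; rewrite inE.
have hii : ~~ ([set i] \subset hull H) by rewrite sub1set.
have ri : rank ([set i] :: H) = (rank H).+1 by rewrite rank_cons hii addn1.
have i1 : i \in hull ([set i] :: H).
  have : i |: hull H \subset hull ([set i] :: H).
    apply: sub_hull; rewrite ri cover_cost_cons sub1set setU11 addn0.
    apply/eqP; rewrite eqn_leq; apply/andP; split; last first.
      have := rank_le_cover ([set i] :: H) (i |: hull H).
      by rewrite ri cover_cost_cons sub1set setU11 addn0.
    rewrite -cover_cost_hull /cover_cost cardsU1 hi add1n addSn ltnS leq_add2l.
    apply: sub_count => M; apply: contra => /subset_trans; apply.
    exact: subsetUr.
  by move/subsetP; apply; rewrite setU11.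
have N1 : N \subset hull ([set i] :: H).
  apply/subsetP => j jN; case: (boolP (j \in hull H)) => [/(subsetP (hull_cons _ _))//|jh].
  have : j \in N :&: avoidable H by rewrite !inE jN jh.
  by rewrite hN inE => /eqP ->.
have sub : hull ([set i] :: H) \subset hull (N :: H).
  apply: sub_hull; rewrite rank_cons hN' addn1 -ri -[RHS]cover_cost_hull.
  by rewrite !cover_cost_cons N1 sub1set i1.
by rewrite /avoidable setCS sub inE negbK (subsetP sub).
Qed.

(** The set [hull (N :: H)] contains [N], hence [i], so it costs the same for [N :: H] and for
    [[set i] :: H]. Both lists have rank one above [H]; hence it is a minimiser for the second list
    too, and [sub_hull] applies. *)
Lemma double_hit N H i : i \in N -> i \in avoidable H ->
  N :&: avoidable (N :: H) = set0 ->
  (N :\ i) :&: avoidable ([set i] :: H) = set0.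
Proof.
move=> iN; rewrite inE => iH /eqP; rewrite disjoint_avoidable => NT.
have hN' : ~~ (N \subset hull H) by apply: contra iH => /subsetP; apply.
have := cover_cost_hull (N :: H); rewrite cover_cost_cons NT addn0 => hc.
apply/eqP; rewrite disjoint_avoidable.
apply: subset_trans (subD1set _ _) _; apply: subset_trans (NT) _.
apply: sub_hull; rewrite cover_cost_cons rank_cons !sub1set iH.
by rewrite (subsetP NT) // hc rank_cons hN' addn0.
Qed.

(** Without the supply [i] the other supplies are harder to avoid. A set containing [i] costs, for
    [H], one more than its trace costs for the reduced list, which allows the largest minimisers to
    be compared. *)
Lemma avoidable_remove i H :
  avoidable [seq N :\ i | N <- H] :\ i \subset avoidable H.
Proof.
set H' := map _ _.
have count_rem T : count (fun N => ~~ (N \subset T)) H' =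
    count (fun N => ~~ (N \subset i |: T)) H.
  by rewrite count_map; apply: eq_count => N /=; rewrite subDset.
have cU T : i \notin T -> cover_cost H (i |: T) = (cover_cost H' T).+1.
  by move=> iT; rewrite /cover_cost count_rem cardsU1 iT.
have cI T : i \in T -> cover_cost H' T = cover_cost H T.
  move=> iT; rewrite /cover_cost count_rem; congr (_ + count _ _).
  by have /setUidPr -> : [set i] \subset T by rewrite sub1set.
(* If [i] is in [hull H], the deletion lowers the rank by one and [hull H :\ i] is a minimiser.
   Otherwise every [T] containing [i] costs more than [rank H], so the rank is unchanged and
   [hull H] itself is a minimiser. *)
have sub : hull H :\ i \subset hull H'.
  case: (boolP (i \in hull H)) => ih.
    have e : (cover_cost H' (hull H :\ i)).+1 = rank H.
      by rewrite -cU ?setD1K ?cover_cost_hull // !inE eqxx.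
    apply: sub_hull; apply/esym; apply: rank_attained => [T|]; last by exists (hull H :\ i).
    rewrite -ltnS e; case: (boolP (i \in T)) => iT.
      by rewrite cI // leqW // rank_le_cover.
    by rewrite -cU // rank_le_cover.
  have lt T : i \in T -> rank H < cover_cost H T.
    move=> iT; rewrite ltn_neqAle rank_le_cover andbT.
    by apply: contra ih => /eqP/esym/sub_hull/subsetP; apply.
  have le T : rank H <= cover_cost H' T.
    case: (boolP (i \in T)) => iT; first by rewrite cI // rank_le_cover.
    by rewrite -ltnS -cU // lt // setU11.
  have e : cover_cost H' (hull H) = rank H.
    apply/eqP; rewrite eqn_leq le andbT -ltnS -cU // -cover_cost_hull.
    rewrite /cover_cost cardsU1 ih add1n addSn ltnS leq_add2l.
    apply: sub_count => M; apply: contra => /subset_trans; apply.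
    exact: subsetUr.
  apply: subset_trans (subD1set _ _) _; apply: sub_hull; rewrite e.
  by apply/esym; apply: rank_attained => //; exists (hull H).
apply/subsetP => j; rewrite !inE => /andP[ji]; apply: contra => jh.
by apply: (subsetP sub); rewrite !inE ji.
Qed.

(** An isolated supply in a cover is paid for without covering anything, so a minimiser cannot
    contain it. *)
Lemma avoidable_isolated i H : {in H, forall N, i \notin N} -> i \in avoidable H.
Proof.
move=> hi; rewrite inE; apply/negP => ih.
have := rank_le_cover H (hull H :\ i); rewrite -cover_cost_hull /cover_cost.
rewrite (cardsD1 i (hull H)) ih add1n addSn.
have -> : count (fun N => ~~ (N \subset hull H :\ i)) H =
    count (fun N => ~~ (N \subset hull H)) H.
  by apply: eq_in_count => N /hi iN; rewrite subsetD1 iN andbT.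
by rewrite ltnn.
Qed.

Lemma rank_cat_cons H N H' : rank (H ++ H') <= rank (H ++ N :: H') <= (rank (H ++ H')).+1.
Proof.
have -> : rank (H ++ N :: H') = rank (N :: H ++ H').
  by apply: perm_rank; rewrite perm_catC /= perm_cons perm_catC.
by rewrite rank_cons; case: (_ \subset _); rewrite ?addn0 ?addn1 leqnSn leqnn.
Qed.

Lemma rank_set0 H : rank (set0 :: H) = rank H.
Proof. by rewrite rank_cons sub0set addn0. Qed.

Lemma rank_le_cover_union H (D : {set I}) :
  {in H, forall N, N \subset D} -> rank H <= #|D|.
Proof.
move=> hD; apply: leq_trans (rank_le_cover H D) _.
rewrite /cover_cost -[leqRHS]addn0 leq_add2l leqn0 -[_ == 0]negbK -lt0n -has_count.
by apply/hasPn => N /hD; rewrite negbK.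
Qed.

Lemma card_hull H : #|hull H| = #|I| - #|avoidable H|.
Proof. by rewrite /avoidable -(cardsC (hull H)) addnK. Qed.

(** A single neighbour outside [hull H] raises the rank as much as the whole of [N] does. *)
Lemma rank_shrink N H : exists N',
  [/\ N' \subset N, #|N'| <= 1 & rank (N' :: H) = rank (N :: H)].
Proof.
case: (boolP (N \subset hull H)) => [hN|/subsetPn[i iN ih]].
  by exists set0; rewrite sub0set cards0 rank_set0 rank_cons hN addn0.
exists [set i]; rewrite sub1set cards1 !rank_cons sub1set ih.
by have /negbTE -> : ~~ (N \subset hull H) by apply/subsetPn; exists i.
Qed.

Lemma rank_shrink_all (J : eqType) (N : J -> {set I}) (s : seq J) H : uniq s ->
  exists N' : J -> {set I}, (forall j, N' j \subset N j /\ #|N' j| <= 1) /\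
    rank (map N' s ++ H) = rank (map N s ++ H).
Proof.
elim: s H => [|j s IH] H /=.
  by exists (fun=> set0); split=> // j; rewrite sub0set cards0.
(* The other demands are shrunk first, in the presence of the full demand [j]; then [j] is shrunk in
   the presence of the shrunken ones. *)
case/andP=> js us; have [N1 [hN1 r1]] := IH (N j :: H) us.
have [M [sM cM rM]] := rank_shrink (N j) (map N1 s ++ H).
have perm_mid (A : {set I}) K : rank (A :: K ++ H) = rank (K ++ A :: H).
  apply: perm_rank; rewrite -cat_cons perm_sym -cat_rcons perm_cat2r.
  by rewrite perm_rcons.
exists (fun k => if k == j then M else N1 k); split=> [k|].
  by case: eqP => [->|].
rewrite eqxx [RHS]perm_mid -r1 -perm_mid -rM.
have -> // : [seq (if k == j then M else N1 k) | k <- s] = map N1 s.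
by apply/eq_in_map => k ks; case: eqP ks js => // -> ->.
Qed.

End TransversalRank.

(** * Konig's theorem: the rank is the matching number *)

Section Konig.
Variable n : nat.
Implicit Types (E M : {set 'I_n * 'I_n}) (i j : 'I_n).

Definition neighbours E j : {set 'I_n} := [set i | (i, j) \in E].

Definition columns E : seq {set 'I_n} := [seq neighbours E j | j <- enum 'I_n].

(* Demands shrunk to at most one supply each, at constant rank, exhibit a
   matching: keep one demand for each supply that is still used. *)
Lemma rank_le_max_matching E : rank (columns E) <= max_matching E.
Proof.
have [N' [hN']] := rank_shrink_all (neighbours E) [::] (enum_uniq 'I_n).
rewrite !cats0 => <-; set D := \bigcup_j N' j.
pose g i := odflt i [pick j | i \in N' j].
have gP i : i \in D -> i \in N' (g i).
  case/bigcupP=> j _ ij; rewrite /g; case: pickP => //= h.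
  by have := h j; rewrite ij.
have small i k j : i \in N' j -> k \in N' j -> i = k.
  by have [_ /card_le1_eqP h] := hN' j => hi hk; apply: h.
apply: (@leq_trans #|D|).
  apply: rank_le_cover_union => N /mapP[j _ ->]; exact: bigcup_sup.
have -> : #|D| = #|[set (i, g i) | i in D]|.
  by rewrite card_imset // => i k [].
apply: (@leq_bigmax_cond _ _ (fun M => #|M|)); apply/andP; split.
  apply/subsetP => _ /imsetP[i iD ->].
  by have [/subsetP h _] := hN' (g i); have := h i (gP i iD); rewrite inE.
apply/forall_inP => _ /imsetP[i iD ->]; apply/forall_inP => _ /imsetP[k kD ->].
apply/implyP => ne /=.
have ik : i != k by apply: contra ne => /eqP ->.
rewrite ik /=; apply: contra ik => /eqP gik; apply/eqP.
by apply: (small _ _ (g i)); [exact: gP | rewrite gik; exact: gP].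
Qed.

(** Weak duality: each edge of a matching has its supply in [T] or its demand among those with a
    neighbour outside [T], and distinct edges use distinct ones. *)
Lemma max_matching_le_rank E : max_matching E <= rank (columns E).
Proof.
apply/bigmax_leqP => M /andP[/subsetP ME /forall_inP hM].
have hM' e f : e \in M -> f \in M -> e != f -> (e.1 != f.1) /\ (e.2 != f.2).
  by move=> eM fM ef; have /forall_inP/(_ f fM)/implyP/(_ ef)/andP := hM e eM.
rewrite -cover_cost_hull /cover_cost; set T := hull _.
have -> : count (fun N : {set 'I_n} => ~~ (N \subset T)) (columns E) =
    #|[set j | ~~ (neighbours E j \subset T)]|.
  by rewrite count_map cardsE cardE {2}/enum_mem size_filter enumT; apply: eq_count.
pose M1 := [set e in M | e.1 \in T].
have -> : #|M| = #|M1| + #|M :\: M1|.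
  rewrite -(cardsID M1 M) (setIidPr _) //.
  by apply/subsetP => e /setIdP[].
apply: leq_add.
  have -> : #|M1| = #|[set e.1 | e in M1]|.
    rewrite card_in_imset // => e f /setIdP[eM _] /setIdP[fM _] ef.
    by apply/eqP; apply: contraT => /(hM' _ _ eM fM)[/eqP].
  by apply: subset_leq_card; apply/subsetP => _ /imsetP[e /setIdP[_ eT] ->].
have -> : #|M :\: M1| = #|[set e.2 | e in M :\: M1]|.
  rewrite card_in_imset // => e f /setDP[eM _] /setDP[fM _] ef.
  by apply/eqP; apply: contraT => /(hM' _ _ eM fM)[_ /eqP].
apply: subset_leq_card; apply/subsetP => _ /imsetP[[i j] /setDP[eM eT] ->].
rewrite inE; apply/subsetPn; exists i; first by rewrite inE ME.
by apply: contra eT => iT; rewrite inE eM.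
Qed.

Lemma max_matchingE E : max_matching E = rank (columns E).
Proof. by apply/eqP; rewrite eqn_leq max_matching_le_rank rank_le_max_matching. Qed.

End Konig.

(** * Expectations over independent draws *)

Section IidMean.
Local Open Scope ring_scope.
Variables (R : realFieldType).

Definition is_law (X : finType) (mu : X -> R) : Prop :=
  (forall x, 0 <= mu x) /\ \sum_x mu x = 1.

(** The recursion makes conditioning on the first draw definitional; [iid_mean_ffun] recovers the
    sum over the product space. *)
Fixpoint iid_mean (X : finType) (mu : X -> R) (m : nat) (f : seq X -> R) : R :=
  if m is m'.+1 then \sum_x mu x * iid_mean mu m' (fun H => f (x :: H))
  else f [::].

Section Basic.
Variables (X : finType) (mu : X -> R).
Implicit Types (f g : seq X -> R) (H : seq X).

Lemma eq_iid_mean m f g : (forall H, size H = m -> f H = g H) ->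
  iid_mean mu m f = iid_mean mu m g.
Proof.
elim: m f g => [|m IH] f g fg /=; first exact: fg.
by apply: eq_bigr => x _; congr (_ * _); apply: IH => H hH; rewrite fg //= hH.
Qed.

Lemma iid_mean_sum (I : Type) (r : seq I) (P : pred I) (F : I -> seq X -> R) m :
  iid_mean mu m (fun H => \sum_(i <- r | P i) F i H) =
  \sum_(i <- r | P i) iid_mean mu m (F i).
Proof.
elim: m F => [//|m IH] F /=; rewrite exchange_big /=.
by apply: eq_bigr => x _; rewrite IH mulr_sumr.
Qed.

Lemma iid_meanD m f g :
  iid_mean mu m (fun H => f H + g H) = iid_mean mu m f + iid_mean mu m g.
Proof.
elim: m f g => [//|m IH] f g /=; rewrite -big_split /=.
by apply: eq_bigr => x _; rewrite IH mulrDr.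
Qed.

Lemma iid_meanZ m (a : R) f :
  iid_mean mu m (fun H => a * f H) = a * iid_mean mu m f.
Proof.
elim: m f => [//|m IH] f /=; rewrite mulr_sumr.
by apply: eq_bigr => x _; rewrite IH mulrCA.
Qed.

Lemma iid_meanN m f : iid_mean mu m (fun H => - f H) = - iid_mean mu m f.
Proof.
rewrite -mulN1r -iid_meanZ; apply: eq_iid_mean => H _; by rewrite mulN1r.
Qed.

Lemma iid_meanB m f g :
  iid_mean mu m (fun H => f H - g H) = iid_mean mu m f - iid_mean mu m g.
Proof. by rewrite iid_meanD iid_meanN. Qed.

Hypothesis mu_law : is_law mu.

Lemma iid_mean_cst m (a : R) : iid_mean mu m (fun=> a) = a.
Proof.
elim: m => [//|m IH] /=; under eq_bigr do rewrite IH.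
by rewrite -mulr_suml (proj2 mu_law) mul1r.
Qed.

Lemma ler_iid_mean m f g : (forall H, size H = m -> f H <= g H) ->
  iid_mean mu m f <= iid_mean mu m g.
Proof.
elim: m f g => [|m IH] f g fg /=; first exact: fg.
apply: ler_sum => x _; apply: ler_wpM2l; first exact: (proj1 mu_law).
by apply: IH => H hH; apply: fg; rewrite /= hH.
Qed.

Lemma ler_iid_mean_add f m d : (forall x H, f H <= f (x :: H)) ->
  iid_mean mu m f <= iid_mean mu (d + m) f.
Proof.
move=> hf; elim: d => [//|d IH]; rewrite addSn; apply: le_trans IH _.
rewrite /= -[leLHS]mul1r -(proj2 mu_law) mulr_suml; apply: ler_sum => x _.
apply: ler_wpM2l; first exact: (proj1 mu_law).
exact: ler_iid_mean.
Qed.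

Lemma law_mean_bound (g : X -> R) (x0 : X) : (forall x y, `|g x - g y| <= 1) ->
  `|g x0 - \sum_x mu x * g x| <= 1.
Proof.
move=> hg.
have -> : g x0 - \sum_x mu x * g x = \sum_x mu x * (g x0 - g x).
  under [RHS]eq_bigr do rewrite mulrBr.
  by rewrite sumrB -mulr_suml (proj2 mu_law) mul1r.
apply: le_trans (ler_norm_sum _ _ _) _.
rewrite -(proj2 mu_law); apply: ler_sum => x _.
by rewrite normrM ger0_norm ?(proj1 mu_law) // ler_piMr ?(proj1 mu_law).
Qed.

(** Martingale decomposition: conditioning on the first draw splits the variance into the mean
    conditional variance and the variance of the conditional mean [g]. The latter is at most 1
    because [g] oscillates by at most 1. *)
Lemma iid_mean_variance m f :
  (forall H1 x y H2, `|f (H1 ++ x :: H2) - f (H1 ++ y :: H2)| <= 1) ->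
  iid_mean mu m (fun H => (f H - iid_mean mu m f) ^+ 2) <= m%:R.
Proof.
elim: m f => [|m IH] f hf /=; first by rewrite subrr expr0n.
set g := fun x => iid_mean mu m (fun H => f (x :: H)).
set c := \sum_x mu x * g x.
have hg x y : `|g x - g y| <= 1.
  rewrite /g -iid_meanB; rewrite ler_norml; apply/andP; split.
    rewrite -[leLHS](iid_mean_cst m); apply: ler_iid_mean => H _.
    by have := hf [::] x y H; rewrite ler_norml => /andP[].
  rewrite -[leRHS](iid_mean_cst m); apply: ler_iid_mean => H _.
  by have := hf [::] x y H; rewrite ler_norml => /andP[].
have -> : m.+1%:R = \sum_x mu x * (m%:R + 1).
  by rewrite -mulr_suml (proj2 mu_law) mul1r natr1.
apply: ler_sum => x _; apply: ler_wpM2l; first exact: (proj1 mu_law).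
have -> : iid_mean mu m (fun H => (f (x :: H) - c) ^+ 2) =
    iid_mean mu m (fun H => (f (x :: H) - g x) ^+ 2) + (g x - c) ^+ 2.
  have cross : iid_mean mu m (fun H => 2 * (g x - c) * (f (x :: H) - g x)) = 0.
    rewrite (iid_meanZ m (2 * (g x - c)) (fun H => f (x :: H) - g x)).
    by rewrite iid_meanB iid_mean_cst -/(g x) subrr mulr0.
  rewrite -[X in _ = _ + X](iid_mean_cst m) -iid_meanD -[RHS]addr0 -cross -iid_meanD.
  by apply: eq_iid_mean => H _; ring.
apply: lerD; first by apply: IH => H1 y z H2; exact: (hf (x :: H1)).
have := law_mean_bound x hg; rewrite -/c => h.
by rewrite -real_normK ?num_real // expr_le1.
Qed.

Lemma chebyshev_iid_mean m f (a : R) : 0 < a ->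
  (forall H1 x y H2, `|f (H1 ++ x :: H2) - f (H1 ++ y :: H2)| <= 1) ->
  iid_mean mu m (fun H => (a <= `|f H - iid_mean mu m f|)%R%:R) <= m%:R / a ^+ 2.
Proof.
move=> a0 hf; rewrite ler_pdivlMr ?exprn_gt0 // mulrC -iid_meanZ.
apply: le_trans (iid_mean_variance m hf); apply: ler_iid_mean => H _.
case: (leP a) => [h|_]; last by rewrite mulr0 sqr_ge0.
rewrite mulr1 -[leRHS]real_normK ?num_real //.
by apply: lerXn2r => //; rewrite nnegrE ?normr_ge0 ?ltW.
Qed.

(** A Mecke-type identity: as [psi] ignores the order of its list, each of the [m.+1] draws
    contributes as much as the first one. *)
Lemma iid_mean_count m (psi : X -> seq X -> R) :
  (forall x H H', perm_eq H H' -> psi x H = psi x H') ->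
  iid_mean mu m.+1 (fun H => \sum_(x <- H) psi x H) =
  m.+1%:R * iid_mean mu m (fun H => \sum_x mu x * psi x (x :: H)).
Proof.
elim: m psi => [|m IH] psi hpsi.
  by rewrite mul1r /=; apply: eq_bigr => x _; rewrite big_seq1.
set E := (X in _ = _ * X).
transitivity (\sum_x mu x * iid_mean mu m.+1 (fun H => psi x (x :: H)) +
   \sum_x mu x * iid_mean mu m.+1 (fun H => \sum_(y <- H) psi y (x :: H))).
  rewrite -big_split /=; apply: eq_bigr => x _; rewrite -mulrDr; congr (_ * _).
  rewrite /= -big_split /=; apply: eq_bigr => y _; rewrite -mulrDr -iid_meanD; congr (_ * _).
  by apply: eq_iid_mean => H _; rewrite big_cons.
have -> : \sum_x mu x * iid_mean mu m.+1 (fun H => psi x (x :: H)) = E.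
  by rewrite /E iid_mean_sum; apply: eq_bigr => x _; rewrite iid_meanZ.
suff -> : \sum_x mu x * iid_mean mu m.+1 (fun H => \sum_(y <- H) psi y (x :: H))
    = m.+1%:R * E by rewrite -[m.+2%:R]natr1; ring.
transitivity (\sum_x mu x * (m.+1%:R *
    iid_mean mu m (fun H => \sum_y mu y * psi y (x :: y :: H)))).
  apply: eq_bigr => x _; congr (_ * _).
  by rewrite (IH (fun y H => psi y (x :: H))) // => y H H' hH; apply: hpsi; rewrite perm_cons.
rewrite /E /= mulr_sumr; apply: eq_bigr => x _; rewrite mulrCA; congr (_ * (_ * _)).
apply: eq_iid_mean => H _; apply: eq_bigr => y _; congr (_ * _).
by apply: hpsi; rewrite -cat1s -[_ :: H]cat1s perm_catCA.
Qed.

End Basic.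

Lemma iid_mean_map (X Y : finType) (mu : X -> R) (nu : Y -> R) (h : X -> Y) m f :
  (forall F, \sum_y nu y * F y = \sum_x mu x * F (h x)) ->
  iid_mean nu m f = iid_mean mu m (fun H => f (map h H)).
Proof.
move=> hnu; elim: m f => [//|m IH] f /=; rewrite hnu.
by apply: eq_bigr => x _; rewrite IH.
Qed.

(* Lindeberg replacement of the draws, one at a time. *)
Lemma iid_mean_replace (X Y : finType) (la : X -> R) (rho : Y -> R)
    (Z : finType) (i1 : X -> Z) (i2 : Y -> Z) (b : R) (f : seq Z -> R) :
  is_law la -> is_law rho ->
  (forall H H', perm_eq H H' -> f H = f H') ->
  (forall H, \sum_x la x * f (i1 x :: H) <= b + \sum_y rho y * f (i2 y :: H)) ->
  forall m, iid_mean la m (fun H => f (map i1 H)) <=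
    m%:R * b + iid_mean rho m (fun H => f (map i2 H)).
Proof.
move=> hla hrho hf hstep m.
(* The context [K] holds draws that are not yet replaced: the later draws are replaced first, and
   [hstep] then treats the head. *)
suff gen : forall K, iid_mean la m (fun H => f (map i1 H ++ K)) <=
    m%:R * b + iid_mean rho m (fun H => f (map i2 H ++ K)).
  have := gen [::]; congr (_ <= _ + _); apply: eq_iid_mean => H _; by rewrite cats0.
elim: m => [|m IH] K /=; first by rewrite mul0r add0r.
have perm_mid (z : Z) A : f ((z :: A) ++ K) = f (A ++ z :: K).
  by apply: hf; rewrite -cat_rcons perm_cat2r perm_sym perm_rcons.
apply: (@le_trans _ _ (\sum_x la x *
    (m%:R * b + iid_mean rho m (fun H => f (map i2 H ++ i1 x :: K))))).
  apply: ler_sum => x _; apply: ler_wpM2l; first exact: (proj1 hla).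
  apply: le_trans (IH (i1 x :: K)); rewrite le_eqVlt; apply/orP; left; apply/eqP.
  by apply: eq_iid_mean => H _ /=; rewrite -perm_mid.
under [leLHS]eq_bigr do rewrite mulrDr.
rewrite big_split /= -mulr_suml (proj2 hla) mul1r -natr1 mulrDl mul1r -addrA lerD2l.
have -> : \sum_x la x * iid_mean rho m (fun H => f (map i2 H ++ i1 x :: K)) =
   iid_mean rho m (fun H => \sum_x la x * f (i1 x :: map i2 H ++ K)).
  rewrite iid_mean_sum; apply: eq_bigr => x _; rewrite iid_meanZ; congr (_ * _).
  by apply: eq_iid_mean => H _; rewrite -perm_mid.
have -> : \sum_y rho y * iid_mean rho m (fun H => f (i2 y :: map i2 H ++ K)) =
   iid_mean rho m (fun H => \sum_y rho y * f (i2 y :: map i2 H ++ K)).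
  by rewrite iid_mean_sum; apply: eq_bigr => x _; rewrite iid_meanZ.
rewrite -[b in leRHS](iid_mean_cst hrho m) -iid_meanD.
by apply: ler_iid_mean.
Qed.

(* Expectation of [A k (m - k)] for a binomial variable [k] of parameters [m]
   and [e], computed one trial at a time. *)
Fixpoint bin_mean (e : R) (m : nat) (A : nat -> nat -> R) : R :=
  if m is m'.+1 then (1 - e) * bin_mean e m' (fun k l => A k l.+1)
                     + e * bin_mean e m' (fun k l => A k.+1 l)
  else A 0 0.

Lemma eq_bin_mean e m A B : (forall k l, (k + l)%N = m -> A k l = B k l) ->
  bin_mean e m A = bin_mean e m B.
Proof.
elim: m A B => [|m IH] A B hAB /=; first exact: hAB.
congr (_ * _ + _ * _); apply: IH => k l kl; apply: hAB; by rewrite ?addnS ?addSn kl.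
Qed.

Lemma ler_bin_mean e m A B : 0 <= e <= 1 ->
  (forall k l, (k + l)%N = m -> A k l <= B k l) ->
  bin_mean e m A <= bin_mean e m B.
Proof.
case/andP=> e0 e1; elim: m A B => [|m IH] A B hAB /=; first exact: hAB.
apply: lerD; apply: ler_wpM2l; rewrite ?subr_ge0 //; apply: IH => k l kl; apply: hAB;
  by rewrite ?addnS ?addSn kl.
Qed.

Lemma bin_meanD e m A B :
  bin_mean e m (fun k l => A k l + B k l) = bin_mean e m A + bin_mean e m B.
Proof. by elim: m A B => [//|m IH] A B /=; rewrite !IH; ring. Qed.

Lemma bin_meanZ e m (a : R) A :
  bin_mean e m (fun k l => a * A k l) = a * bin_mean e m A.
Proof. by elim: m A => [//|m IH] A /=; rewrite !IH; ring. Qed.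

Lemma bin_mean_sum e m (I : finType) (F : I -> nat -> nat -> R) :
  bin_mean e m (fun k l => \sum_i F i k l) = \sum_i bin_mean e m (F i).
Proof.
elim: m F => [//|m IH] F /=; rewrite !IH !mulr_sumr -big_split /=.
by apply: eq_bigr.
Qed.

Lemma bin_mean_cst e m (a : R) : bin_mean e m (fun _ _ => a) = a.
Proof. by elim: m => [//|m IH] /=; rewrite IH; ring. Qed.

Lemma bin_mean_id e m : bin_mean e m (fun k _ => k%:R) = m%:R * e.
Proof.
elim: m => [|m IH] /=; first by rewrite mul0r.
rewrite IH; have -> : bin_mean e m (fun k _ => k.+1%:R) = m%:R * e + 1.
  rewrite -[X in _ + X](bin_mean_cst e m) -IH -bin_meanD.
  by apply: eq_bin_mean => k l _ /=; rewrite natr1.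
by rewrite -natr1; ring.
Qed.

Lemma bin_mean_exp e m (x : R) :
  bin_mean e m (fun k _ => x ^+ k) = (1 - e + e * x) ^+ m.
Proof.
elim: m => [|m IH] /=; first by rewrite !expr0.
rewrite IH exprS; have -> : bin_mean e m (fun k _ => x ^+ k.+1) = x * (1 - e + e * x) ^+ m.
  by rewrite -IH -bin_meanZ; apply: eq_bin_mean => k l _; rewrite exprS.
by ring.
Qed.

(** The centre [c] is arbitrary because a success shifts it by one in the induction. *)
Lemma bin_mean_sqr e m (c : R) :
  bin_mean e m (fun k _ => (k%:R - c) ^+ 2) =
  m%:R * (e * (1 - e)) + (m%:R * e - c) ^+ 2.
Proof.
elim: m c => [|m IH] c /=; first by ring.
have -> : bin_mean e m (fun k _ => (k.+1%:R - c) ^+ 2) =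
    bin_mean e m (fun k _ => (k%:R - (c - 1)) ^+ 2).
  by apply: eq_bin_mean => k l _; rewrite -natr1; ring.
by rewrite !IH -natr1; ring.
Qed.

Section Splitting.
Variable X : finType.
Implicit Types (mu al be : X -> R) (H t h : seq X).

(** A draw of [x0] does not affect [f], so only the binomially many proper draws matter. *)
Lemma iid_mean_lazy mu (x0 : X) (e : R) m f :
  (forall H H', f (H ++ x0 :: H') = f (H ++ H')) ->
  iid_mean (fun x => (1 - e) * (x == x0)%:R + e * mu x) m f =
  bin_mean e m (fun k _ => iid_mean mu k f).
Proof.
elim: m f => [//|m IH] f hf /=.
under eq_bigr do rewrite mulrDl.
rewrite big_split /=; congr (_ + _).
  rewrite (bigD1 x0) //= eqxx mulr1 big1 ?addr0 => [|x /negbTE ->]; last first.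
    by rewrite mulr0 mul0r.
  rewrite IH; last by move=> H H'; exact: (hf (x0 :: H)).
  congr (_ * _); apply: eq_bin_mean => k l _; apply: eq_iid_mean => H _.
  exact: (hf [::]).
under eq_bigr do rewrite -mulrA.
rewrite -mulr_sumr; congr (_ * _); rewrite bin_mean_sum.
apply: eq_bigr => x _; rewrite bin_meanZ; congr (_ * _); apply: IH => H H'.
exact: (hf (x :: H)).
Qed.

(* A draw from [mu] is a draw from [be] with probability [e] and a draw from [al]
   otherwise; the draws from [be] are then independent given those from [al]. *)
Lemma iid_mean_split_le mu al be (e : R) (psi : seq X -> R)
    (g : X -> seq X -> R) m :
  0 <= e <= 1 -> (forall x, 0 <= al x) -> (forall x, 0 <= be x) ->
  (forall x, mu x = (1 - e) * al x + e * be x) ->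
  (forall H H', perm_eq H H' -> psi H = psi H') ->
  (forall x H H', perm_eq H H' -> g x H = g x H') ->
  (forall t h, psi (t ++ h) <= \prod_(x <- t) g x h) ->
  iid_mean mu m psi <=
  bin_mean e m (fun k l => iid_mean al l (fun h => (\sum_x be x * g x h) ^+ k)).
Proof.
move=> /andP[e0 e1] al0 be0 mu_split hpsi hg hpath.
pose G h := \sum_x be x * g x h.
have hG H H' : perm_eq H H' -> G H = G H'.
  by move=> hH; apply: eq_bigr => x _; rewrite (hg _ _ _ hH).
(* The lists [t] and [h0] hold the [be] draws and the [al] draws made so far. The factors [g x] are
   kept unevaluated until all [al] draws are known; averaging each then gives one factor [G]. *)
suff gen : forall t h0, iid_mean mu m (fun H => psi (H ++ t ++ h0)) <=
    bin_mean e m (fun k l => iid_mean al l (fun h =>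
       \prod_(x <- t) g x (h ++ h0) * G (h ++ h0) ^+ k)).
  have -> : iid_mean mu m psi = iid_mean mu m (fun H => psi (H ++ [::] ++ [::])).
    by apply: eq_iid_mean => H _; rewrite !cats0.
  apply: le_trans (gen [::] [::]) _; rewrite le_eqVlt; apply/orP; left; apply/eqP.
  apply: eq_bin_mean => k l _; apply: eq_iid_mean => H _.
  by rewrite big_nil mul1r cats0.
elim: m => [|m IH] t h0 /=; first by rewrite expr0 mulr1; exact: hpath.
under eq_bigr do rewrite mu_split mulrDl -!mulrA.
rewrite big_split /= -!mulr_sumr; apply: lerD.
  apply: ler_wpM2l; first by rewrite subr_ge0.
  rewrite bin_mean_sum; apply: ler_sum => x _; rewrite bin_meanZ.
  apply: ler_wpM2l => //.
  have -> : iid_mean mu m (fun H => psi (x :: H ++ t ++ h0)) =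
      iid_mean mu m (fun H => psi (H ++ t ++ x :: h0)).
    apply: eq_iid_mean => H _; apply: hpsi.
    by rewrite !catA -cat_rcons perm_sym -cat_cons perm_cat2r perm_rcons.
  apply: le_trans (IH t (x :: h0)) _.
  rewrite le_eqVlt; apply/orP; left; apply/eqP.
  apply: eq_bin_mean => k l _; apply: eq_iid_mean => H _.
  have hp : perm_eq (H ++ x :: h0) (x :: H ++ h0).
    by rewrite -cat_rcons -cat_cons perm_cat2r perm_rcons.
  by rewrite (hG _ _ hp); congr (_ * _); apply: eq_bigr => y _; rewrite (hg _ _ _ hp).
apply: ler_wpM2l => //.
apply: (@le_trans _ _ (\sum_x be x * bin_mean e m (fun k l => iid_mean al l (fun h =>
       \prod_(y <- x :: t) g y (h ++ h0) * G (h ++ h0) ^+ k)))).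
  apply: ler_sum => x _; apply: ler_wpM2l => //.
  apply: le_trans (IH (x :: t) h0); rewrite le_eqVlt; apply/orP; left; apply/eqP.
  apply: eq_iid_mean => H _; apply: hpsi; rewrite -[(x :: t) ++ h0]cat1s -cat1s.
  by rewrite perm_catCA.
rewrite le_eqVlt; apply/orP; left; apply/eqP.
under eq_bigr do rewrite -bin_meanZ.
rewrite -bin_mean_sum; apply: eq_bin_mean => k l _.
under eq_bigr do rewrite -iid_meanZ.
rewrite -iid_mean_sum; apply: eq_iid_mean => H _.
rewrite exprS mulrCA /G mulr_suml; apply: eq_bigr => x _.
by rewrite big_cons -!mulrA.
Qed.

End Splitting.

Lemma bin_mean_iid_mean (X : finType) (mu : X -> R) e m p (F : nat -> nat -> seq X -> R) :
  bin_mean e m (fun k l => iid_mean mu p (F k l)) =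
  iid_mean mu p (fun H => bin_mean e m (fun k l => F k l H)).
Proof.
elim: m F => [//|m IH] F /=.
by rewrite iid_meanD !iid_meanZ (IH (fun k l => F k l.+1)) (IH (fun k l => F k.+1 l)).
Qed.

Lemma iid_mean_notin (X : finType) (mu : X -> R) (x : X) m : is_law mu ->
  iid_mean mu m (fun H => (x \notin H)%:R) = (1 - mu x) ^+ m.
Proof.
move=> mu_law; elim: m => [//|m IH] /=.
have e : 1 - mu x = \sum_(y | y != x) mu y.
  by rewrite -(proj2 mu_law) (bigD1 x) //= addrAC subrr add0r.
rewrite exprS -IH {1}e (bigD1 x) //= [X in mu x * X](_ : _ = 0); last first.
  rewrite -[RHS](iid_mean_cst mu_law m); apply: eq_iid_mean => H _.
  by rewrite in_cons eqxx.
rewrite mulr0 add0r mulr_suml; apply: eq_bigr => y yx; congr (_ * _).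
by apply: eq_iid_mean => H _; rewrite in_cons negb_or [x == y]eq_sym yx.
Qed.

Lemma iid_mean_tuple (X : finType) (mu : X -> R) m f :
  iid_mean mu m f = \sum_(t : m.-tuple X) (\prod_(i < m) mu (tnth t i)) * f t.
Proof.
elim: m f => [|m IH] f /=.
  rewrite (bigD1 [tuple]) //= big_ord0 mul1r big1 ?addr0 // => t /eqP[].
  exact: tuple0.
rewrite (reindex (fun p : X * m.-tuple X => [tuple of p.1 :: p.2])) /=; last first.
  exists (fun t : m.+1.-tuple X => (thead t, [tuple of behead t])) => [[x t]|t] _ /=.
    by congr (_, _); apply: val_inj.
  by rewrite -tuple_eta.
rewrite -(pair_big xpredT xpredT (fun x (t : m.-tuple X) =>
   (\prod_(i < m.+1) mu (tnth [tuple of x :: t] i)) * f (x :: t))) /=.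
apply: eq_bigr => x _; rewrite IH mulr_sumr; apply: eq_bigr => t _.
rewrite big_ord_recl tnth0 mulrA; congr (_ * _ * _).
by apply: eq_bigr => i _; rewrite tnthS.
Qed.

Lemma iid_mean_ffun (X : finType) (mu : X -> R) m f :
  iid_mean mu m f =
  \sum_(u : {ffun 'I_m -> X}) (\prod_(i < m) mu (u i)) * f [seq u i | i <- enum 'I_m].
Proof.
rewrite iid_mean_tuple (reindex (fun u : {ffun 'I_m -> X} => [tuple u i | i < m])) /=; last first.
  exists (fun t : m.-tuple X => [ffun i => tnth t i]) => [u|t] _.
    by apply/ffunP => i; rewrite ffunE tnth_mktuple.
  by apply: eq_from_tnth => i; rewrite tnth_mktuple ffunE.
apply: eq_bigr => u _; congr (_ * _).
by apply: eq_bigr => i _; rewrite tnth_mktuple.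
Qed.

Lemma iid_mean_additive (X : finType) (mu : X -> R) m (phi : X -> R) : is_law mu ->
  iid_mean mu m (fun H => \sum_(x <- H) phi x) = m%:R * \sum_x mu x * phi x.
Proof.
move=> mu_law; elim: m => [|m IH] /=; first by rewrite big_nil mul0r.
rewrite -natr1 mulrDl mul1r -IH addrC.
transitivity (\sum_x (mu x * phi x + mu x * iid_mean mu m (fun H => \sum_(y <- H) phi y))).
  apply: eq_bigr => x _; rewrite -mulrDr; congr (_ * _).
  rewrite -[X in _ = X + _](iid_mean_cst mu_law m) -iid_meanD.
  by apply: eq_iid_mean => H _; rewrite big_cons.
by rewrite big_split /= -mulr_suml (proj2 mu_law) mul1r.
Qed.

End IidMean.

(** * Random sets with independent members *)

Section RandomSet.
Local Open Scope ring_scope.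
Variables (R : realType).

Lemma expRN_le (x : R) : 0 <= x -> expR (- x) <= 1 - x + x ^+ 2.
Proof.
move=> x0; have h : 1 + x <= expR x by exact: expR_ge1Dx.
have e0 : 0 < expR x by exact: expR_gt0.
rewrite expRN -[leLHS]mul1r ler_pdivrMr //.
(* The left-hand side equals [1 + x ^+ 3], which is at least 1. *)
have : (1 - x + x ^+ 2) * (1 + x) <= (1 - x + x ^+ 2) * expR x.
  by rewrite ler_wpM2l //; nra.
by nra.
Qed.

Lemma expR_tangent (x y : R) : expR (- y) * (1 + y - x) <= expR (- x).
Proof.
have -> : - x = - y + (y - x) by ring.
rewrite expRD ler_wpM2l ?expR_ge0 //; have := expR_ge1Dx (y - x); lra.
Qed.

Lemma expRN_lipschitz (x y : R) : 0 <= x -> x <= y ->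
  expR (- x) - expR (- y) <= y - x.
Proof.
move=> x0 xy; have := expR_tangent y x.
have : expR (- x) <= 1 by rewrite expR_le1 oppr_le0.
have := expR_ge0 (- x); nra.
Qed.

(** Each factor differs from [expR (- b i)] by at most [b i ^+ 2], and when numbers in [0,1] are
    multiplied their errors at most add up. *)
Lemma prod_onem_expR (I : finType) (S : {set I}) (b : I -> R) :
  (forall i, 0 <= b i <= 1) ->
  let p := \prod_(i in S) (1 - b i) in
  let t := \sum_(i in S) b i in
  [/\ 0 <= p, p <= expR (- t) & expR (- t) - \sum_(i in S) b i ^+ 2 <= p].
Proof.
move=> hb p t.
suff : [/\ 0 <= p, p <= expR (- t), 0 <= t, 0 <= \sum_(i in S) b i ^+ 2 &
    expR (- t) - \sum_(i in S) b i ^+ 2 <= p] by case.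
apply: (big_ind3 (fun p t s => [/\ 0 <= p, p <= expR (- t), 0 <= t, 0 <= s &
    expR (- t) - s <= p])) => [|p1 t1 s1 p2 t2 s2|i _].
- by rewrite oppr0 expR0 addr0; split.
- move=> [p1_ge0 p1_le t1_ge0 s1_ge0 e1] [p2_ge0 p2_le t2_ge0 s2_ge0 e2].
  have := expR_ge0 (- t1); have := expR_ge0 (- t2).
  have : expR (- t1) <= 1 by rewrite expR_le1 oppr_le0.
  have : expR (- t2) <= 1 by rewrite expR_le1 oppr_le0.
  rewrite opprD expRD.
  move: (expR (- t1)) (expR (- t2)) p1_le e1 p2_le e2 => x y p1x e1 p2y e2 y1 x1 y0 x0.
  split; [nra|nra|nra|nra|].
  (* The error of the product is split as [x * y - p1 * p2 = x * (y - p2) + p2 * (x - p1)]. *)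
  have h1 : x * (y - p2) <= s2.
    apply: le_trans (_ : y - p2 <= _); last by lra.
    by rewrite ler_piMl // subr_ge0.
  have h2 : p2 * (x - p1) <= s1.
    apply: le_trans (_ : x - p1 <= _); last by lra.
    by rewrite ler_piMl // ?subr_ge0 //; lra.
  by nra.
- have /andP[b0 b1] := hb i; split=> //.
  + by rewrite subr_ge0.
  + by have := expR_ge1Dx (- b i).
  + exact: sqr_ge0.
  + by have := expRN_le b0; lra.
Qed.

Lemma onem_exp_ge m (x : R) : 0 <= x <= 1 ->
  expR (- (x * m%:R)) - x ^+ 2 * m%:R <= (1 - x) ^+ m.
Proof.
move=> /andP[x0 x1]; elim: m => [|m IH]; first by rewrite !mulr0 oppr0 expR0 addr0 expr0.
have E1 : expR (- (x * m%:R)) <= 1 by rewrite expR_le1 oppr_le0 mulr_ge0.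
have E0 := expR_ge0 (- (x * m%:R)).
have p0 : 0 <= (1 - x) ^+ m by rewrite exprn_ge0 // subr_ge0.
have h := expRN_le x0.
have t0 : 0 <= x ^+ 2 * m%:R by rewrite mulr_ge0 ?sqr_ge0.
rewrite [leRHS]exprS -natr1 mulrDr mulr1 opprD expRD mulrDr mulr1.
move: (expR (- (x * _))) ((1 - x) ^+ m) (expR (- x)) (x ^+ 2) (x ^+ 2 * _) (sqr_ge0 x) t0 E1 E0 p0 h IH.
move=> E p e z t z0 t0 E1 E0 p0 h IH.
have h1 : E * e <= E * (1 - x + z) by rewrite ler_wpM2l.
have h2 : E * z <= z by rewrite ler_piMl.
have h3 : (1 - x) * (E - p) <= t.
  apply: (@le_trans _ _ ((1 - x) * t)); last by rewrite ler_piMl //; lra.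
  by rewrite ler_wpM2l ?subr_ge0 //; lra.
by nra.
Qed.

Lemma prod_onem_bounds (I : finType) (S : {set I}) (b : I -> R) :
  (forall i, 0 <= b i <= 1) ->
  let p := \prod_(i in S) (1 - b i) in
  [/\ 0 <= p, p <= 1 & 1 - \sum_(i in S) b i <= p].
Proof.
move=> hb p.
suff : [/\ 0 <= p, p <= 1, 0 <= \sum_(i in S) b i & 1 - \sum_(i in S) b i <= p] by case.
apply: (big_ind2 (fun p t => [/\ 0 <= p, p <= 1, 0 <= t & 1 - t <= p])) => [|p1 t1 p2 t2|i _].
- by split; rewrite ?subr0.
- by move=> [? ? ? ?] [? ? ? ?]; split; nra.
- by have /andP[? ?] := hb i; split=> //; lra.
Qed.

Lemma prod_onem_diff (I : finType) (A B : {set I}) (b : I -> R) :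
  (forall i, 0 <= b i <= 1) -> A \subset B ->
  0 <= \prod_(i in A) (1 - b i) - \prod_(i in B) (1 - b i)
    <= \sum_(i in B :\: A) b i.
Proof.
move=> hb AB; rewrite [X in _ - X](big_setID A) /= (setIidPr AB).
have [p0 p1 _] := prod_onem_bounds A hb.
have [r0 r1 rs] := prod_onem_bounds (B :\: A) hb.
by apply/andP; split; nra.
Qed.

Section SetLaw.
Variables (I Y : finType) (q : Y -> R) (a : I -> Y -> R).
Implicit Types (N S : {set I}) (y : Y).

Definition set_law_given y N : R := \prod_i (if i \in N then a i y else 1 - a i y).

Definition set_law N : R := \sum_y q y * set_law_given y N.

Lemma sum_prod_sets (F G : I -> R) :
  \sum_(N : {set I}) \prod_i (if i \in N then F i else G i) = \prod_i (F i + G i).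
Proof. by rewrite (@bigA_distr R 0 1 *%R +%R I F G). Qed.

Lemma set_law_mean (F : {set I} -> R) :
  \sum_(N : {set I}) set_law N * F N = \sum_y q y * \sum_(N : {set I}) set_law_given y N * F N.
Proof.
under eq_bigr do rewrite mulr_suml.
rewrite exchange_big /=; apply: eq_bigr => y _; rewrite mulr_sumr.
by apply: eq_bigr => N _; rewrite mulrA.
Qed.

Lemma set_law_given_miss y S :
  \sum_(N : {set I}) set_law_given y N * (N :&: S == set0)%:R = \prod_(i in S) (1 - a i y).
Proof.
rewrite [RHS]big_mkcond /=.
(* Sets meeting [S] are discarded by giving weight 0 to membership of a point of [S]; the sum over
   all sets then factorises. *)
transitivity (\prod_i ((if i \in S then 0 else a i y) + (1 - a i y))); last first.
  by apply: eq_bigr => i _; case: ifP => _; ring.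
rewrite -sum_prod_sets; apply: eq_bigr => N _; rewrite /set_law_given.
case: eqP => [NS|/eqP/set0Pn[i]].
  rewrite mulr1; apply: eq_bigr => i _; case: ifP => // iN; case: ifP => // iS.
  have : i \in N :&: S by rewrite inE iN.
  by rewrite NS inE.
rewrite inE => /andP[iN iS]; rewrite mulr0 [RHS](bigD1 i) //=.
by rewrite iN iS mul0r.
Qed.

Lemma set_law_given_only y S i :
  \sum_(N : {set I}) set_law_given y N * ((i \in N) && ((N :\ i) :&: S == set0))%:R =
  a i y * \prod_(j in S :\ i) (1 - a j y).
Proof.
rewrite [X in _ * X]big_mkcond /=.
transitivity (\prod_j ((if j == i then a i y else if j \in S then 0 else a j y)
   + (if j == i then 0 else 1 - a j y))); last first.
  rewrite (bigD1 i) //= eqxx addr0 [in RHS](bigD1 i) //= !inE eqxx /= mul1r.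
  congr (_ * _); apply: eq_bigr => j /negbTE ji; rewrite !inE ji /=.
  by case: ifP => _; ring.
rewrite -sum_prod_sets; apply: eq_bigr => N _; rewrite /set_law_given.
case: (boolP (i \in N)) => /= iN; last first.
  by rewrite mulr0 [RHS](bigD1 i) //= (negbTE iN) eqxx mul0r.
case: eqP => [NS|/eqP/set0Pn[j]].
  rewrite mulr1; apply: eq_bigr => j _; case: (eqVneq j i) => [->|ji].
    by rewrite iN.
  case: ifP => // jN; case: ifP => // jS.
  have : j \in (N :\ i) :&: S by rewrite !inE jN ji jS.
  by rewrite NS inE.
rewrite !inE => /andP[/andP[ji jN] jS]; rewrite mulr0 [RHS](bigD1 j) //=.
by rewrite jN jS (negbTE ji) mul0r.
Qed.

Hypotheses (q_law : is_law q) (a01 : forall i y, 0 <= a i y <= 1).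

Lemma set_law_given_ge0 y N : 0 <= set_law_given y N.
Proof.
apply: prodr_ge0 => i _; have /andP[? ?] := a01 i y.
by case: ifP => // _; rewrite subr_ge0.
Qed.

Lemma is_law_set_law : is_law set_law.
Proof.
split=> [N|]; first by apply: sumr_ge0 => y _; rewrite mulr_ge0 ?(proj1 q_law) ?set_law_given_ge0.
under eq_bigr do rewrite -[set_law _]mulr1.
rewrite set_law_mean -[RHS](proj2 q_law); apply: eq_bigr => y _.
under eq_bigr do rewrite mulr1.
rewrite sum_prod_sets big1 ?mulr1 // => i _; by rewrite addrC subrK.
Qed.

(** This is the law of [N :\ i] for [N] drawn from [set_law], as [deleted_law_mean] shows. The
    explicit formula permits a pointwise comparison with [set_law]. *)
Definition deleted_law i N : R :=
  \sum_y q y * ((i \notin N)%:R *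
    \prod_(j | j != i) (if j \in N then a j y else 1 - a j y)).

Lemma deleted_law_ge0 i N : 0 <= deleted_law i N.
Proof.
apply: sumr_ge0 => y _; rewrite !mulr_ge0 ?(proj1 q_law) //.
apply: prodr_ge0 => j _; have /andP[? ?] := a01 j y.
by case: ifP => // _; rewrite subr_ge0.
Qed.

Lemma deleted_law_mean i (F : {set I} -> R) :
  \sum_(N : {set I}) deleted_law i N * F N = \sum_(N : {set I}) set_law N * F (N :\ i).
Proof.
rewrite set_law_mean.
transitivity (\sum_y q y * \sum_(N : {set I}) ((i \notin N)%:R *
    \prod_(j | j != i) (if j \in N then a j y else 1 - a j y)) * F N).
  under eq_bigr do rewrite mulr_suml.
  rewrite exchange_big /=; apply: eq_bigr => y _; rewrite mulr_sumr.
  by apply: eq_bigr => N _; rewrite -mulrA.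
apply: eq_bigr => y _; congr (_ * _).
rewrite (bigID (fun N : {set I} => i \in N)) /= big1 ?add0r; last first.
  by move=> N iN; rewrite iN !mul0r.
rewrite [RHS](bigID (fun N : {set I} => i \in N)) /=.
rewrite [X in _ = X + _](reindex_onto (fun N => i |: N) (fun N => N :\ i)) /=; last first.
  by move=> N iN; rewrite setD1K.
rewrite [X in _ = X + _](eq_bigl (fun N : {set I} => i \notin N)); last first.
  move=> N; rewrite setU11 /=; apply/eqP/idP => [<-|iN]; first by rewrite !inE eqxx.
  by rewrite setU1K.
rewrite -big_split /=; apply: eq_bigr => N iN; rewrite setU1K //.
have -> : N :\ i = N.
  by apply/setP => j; rewrite !inE; case: eqP => // ->; rewrite (negbTE iN).
rewrite iN mul1r -mulrDl; congr (_ * _).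
rewrite /set_law_given [in RHS](bigD1 i) //= setU11 [X in _ = _ + X](bigD1 i) //= (negbTE iN).
rewrite [X in a i y * X](_ : _ = \prod_(j | j != i) (if j \in N then a j y else 1 - a j y)).
  by rewrite -mulrDl [_ + (1 - _)]addrC subrK mul1r.
by apply: eq_bigr => j ji; rewrite !inE (negbTE ji).
Qed.

(** Given the type, membership of [i] is independent of the other members and fails with probability
    at least [1 - e]. *)
Lemma deleted_law_le e i N : (forall y, a i y <= e) -> e <= 1 ->
  (1 - e) * deleted_law i N <= set_law N.
Proof.
move=> ae e1; rewrite mulr_sumr; apply: ler_sum => y _.
rewrite mulrCA; apply: ler_wpM2l; first exact: (proj1 q_law).
case: (boolP (i \in N)) => iN; first by rewrite mul0r mulr0 set_law_given_ge0.
rewrite mul1r /set_law_given [leRHS](bigD1 i) //= (negbTE iN).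
apply: ler_wpM2r; last by rewrite lerD2l lerN2.
apply: prodr_ge0 => j _; have /andP[? ?] := a01 j y.
by case: ifP => // _; rewrite subr_ge0.
Qed.

End SetLaw.

End RandomSet.

(** * The mean matching number for fixed supply types *)

Section RankMean.
Local Open Scope ring_scope.
Variables (R : realType) (I Y : finType) (q : Y -> R) (a : I -> Y -> R) (c : R).
Implicit Types (N S : {set I}) (H : seq {set I}) (y : Y) (i : I).

Let n : R := #|I|%:R.

Hypotheses (q_law : is_law q) (a_ge0 : forall i y, 0 <= a i y).
Hypotheses (a_le : forall i y, a i y <= c / n) (n_gt0 : 0 < n).
Hypotheses (c_gt0 : 0 < c) (c_le : c <= n).

Let mu := set_law q a.

Let cn_le1 : c / n <= 1.
Proof. by rewrite ler_pdivrMr // mul1r. Qed.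

Let a01 i y : 0 <= a i y <= 1.
Proof. by rewrite a_ge0 (le_trans (a_le i y)). Qed.

Let mu_law : is_law mu := is_law_set_law q_law a01.

(** This is tau_y(S). *)
Definition load y S : R := \sum_(i in S) a i y.

Lemma load_ge0 y S : 0 <= load y S.
Proof. by apply: sumr_ge0. Qed.

Lemma card_set_le (S : {set I}) : #|S|%:R <= n :> R.
Proof. by rewrite ler_nat max_card. Qed.

Let sum_cst (x : R) : \sum_(i : I) x = x * n.
Proof. by rewrite sumr_const mulr_natr. Qed.

Lemma sum_sqr_le y S : \sum_(i in S) a i y ^+ 2 <= c ^+ 2 / n.
Proof.
apply: (@le_trans _ _ (\sum_(i in S) (c / n) ^+ 2)).
  by apply: ler_sum => i _; rewrite lerXn2r ?nnegrE // ltW // divr_gt0.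
rewrite sumr_const -mulr_natr; have -> : c ^+ 2 / n = (c / n) ^+ 2 * n.
  by field; rewrite lt0r_neq0.
by rewrite ler_wpM2l ?sqr_ge0 // card_set_le.
Qed.

Lemma miss_prob_bounds y S :
  expR (- load y S) - c ^+ 2 / n <= \prod_(i in S) (1 - a i y) <= expR (- load y S).
Proof.
have [_ h1 h2] := prod_onem_expR S (fun i => a01 i y).
apply/andP; split=> //; apply: le_trans h2; rewrite lerD2l lerN2.
exact: sum_sqr_le.
Qed.

Lemma hit_prob S : \sum_(N : {set I}) mu N * (N :&: S != set0)%:R =
  \sum_y q y * (1 - \prod_(i in S) (1 - a i y)).
Proof.
rewrite set_law_mean; apply: eq_bigr => y _; congr (_ * _).
rewrite -set_law_given_miss -[X in X - _](_ : \sum_(N : {set I}) set_law_given a y N * 1 = 1).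
  rewrite -sumrB; apply: eq_bigr => N _; rewrite -mulrBr.
  by case: eqP; rewrite ?subrr ?subr0.
transitivity (\prod_i (a i y + (1 - a i y))).
  by rewrite -sum_prod_sets; apply: eq_bigr => N _; rewrite mulr1.
by rewrite big1 // => i _; rewrite addrC subrK.
Qed.

(** Up to the Poisson error [c ^+ 2 / n], the probability of a hit is the mean of
    [1 - expR (- load y S)], which lies below its tangent at [T y]. The linear part is a sum over
    [S], as for a demand with one random neighbour. *)
Lemma hit_prob_le (T : Y -> R) S :
  \sum_(N : {set I}) mu N * (N :&: S != set0)%:R <=
  \sum_y q y * (1 - expR (- T y) * (1 + T y))
  + \sum_(i in S) \sum_y q y * expR (- T y) * a i y + c ^+ 2 / n.
Proof.
have -> : c ^+ 2 / n = \sum_y q y * (c ^+ 2 / n).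
  by rewrite -mulr_suml (proj2 q_law) mul1r.
rewrite hit_prob exchange_big /= -!big_split /=.
apply: ler_sum => y _; rewrite -mulr_sumr -[_ * _ * \sum_(i in S) _]mulrA -!mulrDr.
apply: ler_wpM2l; first exact: (proj1 q_law).
have /andP[h _] := miss_prob_bounds y S.
have := expR_tangent (load y S) (T y); rewrite -/(load y S).
by move: (expR _) (load y S) h => A B; lra.
Qed.

(* A demand may have to be traded for more than one leaf, and leaves compete.
   Keeping each demand only with probability 1/L makes one leaf suffice. *)
Lemma rank_mean_lazy_le (T : Y -> R) (L m : nat) : (0 < L)%N -> c <= L%:R ->
  (forall y, 0 <= T y) -> m = (L * #|I|)%N ->
  bin_mean L%:R^-1 m (fun k _ => iid_mean mu k (fun H => (rank H)%:R)) <=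
  n * (\sum_y q y * (1 - expR (- T y) * (1 + T y))) + c ^+ 2
  + \sum_i (1 - expR (- (n * \sum_y q y * expR (- T y) * a i y))) + c ^+ 2.
Proof.
move=> L0 cL T0 mE.
have LR0 : 0 < L%:R :> R by rewrite ltr0n.
have c0 := ltW c_gt0.
have mR : m%:R = L%:R * n by rewrite mE natrM.
(* The probability that a leaf is attached to [i]: the slope of the tangent, thinned by [1/L]. The
   condition [c <= L] makes the total weight at most 1. *)
pose w i := (\sum_y q y * expR (- T y) * a i y) / L%:R.
have w0 i : 0 <= w i.
  rewrite divr_ge0 ?ler0n //; apply: sumr_ge0 => y _.
  by rewrite !mulr_ge0 ?expR_ge0 ?(proj1 q_law).
have wle i : w i <= c / n / L%:R.
  rewrite ler_wpM2r ?invr_ge0 ?ler0n // -[leRHS]mul1r -(proj2 q_law) mulr_suml.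
  apply: ler_sum => y _; rewrite -mulrA ler_wpM2l ?(proj1 q_law) //.
  rewrite -[leRHS]mul1r ler_pM ?expR_ge0 //.
  by rewrite expR_le1 oppr_le0.
have wsum : \sum_i w i <= 1.
  apply: (@le_trans _ _ (\sum_(i : I) c / n / L%:R)); first exact: ler_sum.
  rewrite sum_cst mulrAC divfK ?lt0r_neq0 //.
  by rewrite ler_pdivrMr // mul1r.
pose rho (o : option I) := if o is Some i then w i else 1 - \sum_i w i.
have big_opt (F : option I -> R) : \sum_o F o = F None + \sum_i F (Some i).
  rewrite (bigD1 None) //=; congr (_ + _).
  rewrite (reindex_omap Some id) /=; last by case.
  by apply: eq_bigl => i; rewrite eqxx.
have rho_law : is_law rho.
  split=> [[i|] /=|]; rewrite ?subr_ge0 //.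
  by rewrite big_opt /= subrK.
pose leaf (o : option I) : {set I} := if o is Some i then [set i]%SET else set0.
pose la N : R := (1 - L%:R^-1) * (N == set0)%:R + L%:R^-1 * mu N.
have L1 : 0 <= (L%:R^-1 : R) <= 1 by rewrite invr_ge0 ler0n invf_le1 // ler1n.
have la_mean (F : {set I} -> R) : \sum_(N : {set I}) la N * F N =
    (1 - L%:R^-1) * F set0 + L%:R^-1 * \sum_(N : {set I}) mu N * F N.
  under eq_bigr do rewrite mulrDl.
  rewrite big_split /= mulr_sumr; congr (_ + _); last first.
    by apply: eq_bigr => N _; rewrite mulrA.
  rewrite (bigD1 set0) //= eqxx mulr1 big1 ?addr0 // => N /negbTE ->.
  by rewrite mulr0 mul0r.
have la_law : is_law la.
  case/andP: L1 => L10 L11; split=> [N|].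
    by rewrite addr_ge0 // mulr_ge0 ?subr_ge0 ?ler0n ?(proj1 mu_law).
  under eq_bigr do rewrite -[la _]mulr1.
  rewrite la_mean; under eq_bigr do rewrite mulr1.
  by rewrite (proj2 mu_law); ring.
pose B := \sum_y q y * (1 - expR (- T y) * (1 + T y)) + c ^+ 2 / n.
(* Trading one lazy demand for one leaf costs at most [B / L]: the leaf raises the rank exactly when
   it falls in [avoidable H], which matches the linear part of the tangent bound. *)
have step H : \sum_(N : {set I}) la N * (rank (N :: H))%:R <=
    L%:R^-1 * B + \sum_o rho o * (rank (leaf o :: H))%:R.
  have -> : \sum_o rho o * (rank (leaf o :: H))%:R =
      (rank H)%:R + \sum_(i in avoidable H) w i.
    rewrite big_opt /= rank_set0.
    have -> : \sum_i w i * (rank ([set i]%SET :: H))%:R =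
        \sum_i w i * (rank H)%:R + \sum_(i in avoidable H) w i.
      rewrite [X in _ = _ + X]big_mkcond -big_split /=; apply: eq_bigr => i _.
      rewrite rank_cons natrD mulrDr sub1set [i \in avoidable H]inE; congr (_ + _).
      by case: (i \in hull H); rewrite ?mulr0 ?mulr1.
    by rewrite -mulr_suml; ring.
  rewrite la_mean rank_set0.
  have -> : \sum_(N : {set I}) mu N * (rank (N :: H))%:R =
     (rank H)%:R + \sum_(N : {set I}) mu N * (N :&: avoidable H != set0)%:R.
    have e : (rank H)%:R = \sum_(N : {set I}) mu N * (rank H)%:R.
      by rewrite -mulr_suml (proj2 mu_law) mul1r.
    rewrite [X in X + _]e -big_split /=.
    by apply: eq_bigr => N _; rewrite rank_cons_avoidable natrD mulrDr.
  have := hit_prob_le T (avoidable H).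
  have -> : \sum_(i in avoidable H) w i =
    L%:R^-1 * \sum_(i in avoidable H) \sum_y q y * expR (- T y) * a i y.
    by rewrite /w -mulr_suml mulrC.
  move: (\sum_(N : {set I}) _) (\sum_(i in _) _) => A D hA.
  have : L%:R^-1 * A <= L%:R^-1 * (B + D).
    by rewrite ler_wpM2l ?invr_ge0 ?ler0n // /B; lra.
  by rewrite mulrDr; lra.
have -> : bin_mean L%:R^-1 m (fun k _ => iid_mean mu k (fun H => (rank H)%:R)) =
    iid_mean la m (fun H => (rank (map id H))%:R).
  rewrite -[RHS](@eq_iid_mean _ _ _ _ (fun H => (rank H)%:R)); last first.
    by move=> H _; rewrite map_id.
  rewrite iid_mean_lazy // => H H'; congr (_%:R).
  rewrite -[RHS]rank_set0; apply: perm_rank.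
  by rewrite -cat_rcons perm_sym -cat_cons perm_cat2r perm_sym perm_rcons.
apply: le_trans (iid_mean_replace (f := fun H => (rank H)%:R) la_law rho_law _ step m) _.
  by move=> H H' /perm_rank ->.
have -> : m%:R * (L%:R^-1 * B) = n * B by rewrite mR; field; rewrite lt0r_neq0.
suff leaves : iid_mean rho m (fun K => (rank (map leaf K))%:R) <=
    \sum_i (1 - expR (- (n * \sum_y q y * expR (- T y) * a i y)) + c ^+ 2 / n).
  apply: le_trans (lerD (lexx _) leaves) _; rewrite big_split /= sum_cst.
  rewrite divfK ?lt0r_neq0 // /B mulrDr [n * (_ / n)]mulrC divfK ?lt0r_neq0 //.
  by rewrite !addrA.
(* A list of leaves has rank at most the number of supplies that carry a leaf. *)
pose covered (K : seq (option I)) : R := \sum_i (1 - (Some i \notin K)%:R).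
apply: (@le_trans _ _ (iid_mean rho m covered)).
  apply: ler_iid_mean => // K _.
  apply: (@le_trans _ _ #|[set i | Some i \in K]|%:R).
    rewrite ler_nat; apply: rank_le_cover_union => _ /mapP[[i|] oH ->] /=.
      by rewrite sub1set inE.
    exact: sub0set.
  rewrite -sum1_card natr_sum big_mkcond /=; apply: ler_sum => i _.
  by rewrite inE; case: (Some i \in K); rewrite ?subr0 ?subrr.
rewrite iid_mean_sum; apply: ler_sum => i _.
(* The supply [i] carries no leaf with probability [(1 - w i) ^+ m], where [w i * m] is the exponent
   of the claim because [m = L * n]. *)
rewrite iid_meanB iid_mean_cst // iid_mean_notin //=.
  have w1 : w i <= 1.
    apply: le_trans (wle i) _; rewrite ler_pdivrMr // mul1r.
    by apply: le_trans cn_le1 _; rewrite ler1n.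
  have := onem_exp_ge m (introT andP (conj (w0 i) w1)).
  have -> : w i * m%:R = n * \sum_y q y * expR (- T y) * a i y.
    by rewrite mR /w mulrA divfK ?lt0r_neq0 // mulrC.
  suff : w i ^+ 2 * m%:R <= c ^+ 2 / n by lra.
  apply: (@le_trans _ _ ((c / n / L%:R) ^+ 2 * m%:R)).
    by rewrite ler_wpM2r ?ler0n // lerXn2r ?nnegrE // (le_trans (w0 i)).
  rewrite mR [leLHS](_ : _ = c ^+ 2 / n / L%:R); last first.
    by field; rewrite !lt0r_neq0.
  by rewrite ler_pdivrMr // ler_peMr ?ler1n // divr_ge0 ?sqr_ge0 ?ltW.
Qed.

Lemma rank_mean_lipschitz k d :
  iid_mean mu k (fun H => (rank H)%:R) <= iid_mean mu (d + k) (fun H => (rank H)%:R)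
    <= iid_mean mu k (fun H => (rank H)%:R) + d%:R.
Proof.
apply/andP; split.
  by apply: ler_iid_mean_add => // N H; rewrite ler_nat rank_cons leq_addr.
elim: d => [|d IH]; first by rewrite addr0.
rewrite addSn -natr1 addrA; apply: le_trans (lerD IH (lexx 1)).
rewrite /= -[leRHS]mul1r -(proj2 mu_law) mulr_suml; apply: ler_sum => N _.
apply: ler_wpM2l; first exact: (proj1 mu_law).
rewrite (proj2 mu_law) -[X in _ + X](iid_mean_cst mu_law (d + k)) -iid_meanD.
apply: ler_iid_mean => // H _; rewrite natr1 ler_nat rank_cons -addn1 leq_add2l.
by case: (_ \subset _).
Qed.

(** Among [L * n] lazy demands the number kept is binomial of mean [n]. The mean rank is 1-Lipschitz
    in the number of demands, so this number can be replaced by [n] itself. *)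
Lemma rank_mean_le (T : Y -> R) (s : R) : (forall y, 0 <= T y) -> 0 < s ->
  iid_mean mu #|I| (fun H => (rank H)%:R) <=
  n * (\sum_y q y * (1 - expR (- T y) * (1 + T y)))
  + \sum_i (1 - expR (- (n * \sum_y q y * expR (- T y) * a i y)))
  + (2 * c ^+ 2 + s / 2 + n / (2 * s)).
Proof.
move=> T0 s0.
pose L := (Num.truncn c).+1.
have cL : c <= L%:R by apply/ltW; rewrite truncnS_gt.
have LR0 : 0 < L%:R :> R by rewrite ltr0n.
have L1 : 0 <= (L%:R^-1 : R) <= 1 by rewrite invr_ge0 ler0n invf_le1 // ler1n.
pose r k := iid_mean mu k (fun H => (rank H)%:R).
(* The inequality [|x| <= s / 2 + x^2 / (2 s)] trades the absolute deviation for the binomial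
   variance, which is at most [n]. *)
have rdist k : r #|I| <= r k + (s / 2 + (k%:R - n) ^+ 2 / (2 * s)).
  have h : r #|I| <= r k + `|k%:R - n|.
    case: (leqP k #|I|) => hk.
      have /andP[_] := rank_mean_lipschitz k (#|I| - k); rewrite subnK //.
      by rewrite distrC ger0_norm ?subr_ge0 ?ler_nat // -natrB.
    have /andP[+ _] := rank_mean_lipschitz #|I| (k - #|I|); rewrite subnK 1?ltnW //.
    by move=> h; apply: le_trans h _; rewrite lerDl.
  apply: le_trans h _; rewrite lerD2l.
  rewrite -[(k%:R - n) ^+ 2]real_normK ?num_real //.
  set x := `|_|; rewrite -subr_ge0.
  have -> : s / 2 + x ^+ 2 / (2 * s) - x = (x - s) ^+ 2 / (2 * s).
    by field; rewrite lt0r_neq0.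
  by rewrite divr_ge0 ?sqr_ge0 // mulr_ge0 // ltW.
have := @rank_mean_lazy_le T L (L * #|I|) isT cL T0 erefl.
rewrite -/(r #|I|) -[X in X <= _]/(bin_mean L%:R^-1 (L * #|I|) (fun k _ => r k)).
have : r #|I| <= bin_mean L%:R^-1 (L * #|I|) (fun k _ => r k) + (s / 2 + n / (2 * s)).
  rewrite -[leLHS](bin_mean_cst L%:R^-1 (L * #|I|)).
  apply: (le_trans (ler_bin_mean L1 (fun k _ _ => rdist k))).
  rewrite !bin_meanD lerD2l bin_mean_cst lerD2l.
  have -> : bin_mean L%:R^-1 (L * #|I|) (fun k _ => (k%:R - n) ^+ 2 / (2 * s)) =
      bin_mean L%:R^-1 (L * #|I|) (fun k _ => (k%:R - n) ^+ 2) / (2 * s).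
    by rewrite [RHS]mulrC -bin_meanZ; apply: eq_bin_mean => k l _; rewrite [LHS]mulrC.
  rewrite ler_wpM2r ?invr_ge0 ?mulr_ge0 ?(ltW s0) // bin_mean_sqr natrM -/n.
  have e : L%:R * n * L%:R^-1 = n by field; rewrite lt0r_neq0.
  rewrite mulrA e subrr expr0n addr0.
  case/andP: L1 => x0 _; by rewrite ler_piMr ?(ltW n_gt0) // gerBl.
move: (bin_mean _ _ _) (r #|I|) => A B; lra.
Qed.


(** * Lower bound on the mean rank *)

Lemma load_diff y (A B : {set I}) : A \subset B ->
  0 <= load y B - load y A <= c / n * (#|B|%:R - #|A|%:R).
Proof.
move=> AB; rewrite /load (big_setID A) /= (setIidPr AB) addrAC subrr add0r.
rewrite sumr_ge0 //=; apply: (@le_trans _ _ (\sum_(i in B :\: A) c / n)).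
  by apply: ler_sum.
rewrite sumr_const -[c / n *+ _]mulr_natr -(cardsID A B) (setIidPr AB) natrD.
by rewrite addrAC subrr add0r.
Qed.

Lemma load_le y S : load y S <= c.
Proof.
have /andP[_] := load_diff y (sub0set S); rewrite /load big_set0 cards0 !subr0.
move=> /le_trans; apply; rewrite mulrAC ler_pdivrMr // ler_wpM2l ?(ltW c_gt0) //.
exact: card_set_le.
Qed.

(* The demand N meets [avoidable H] but not [avoidable (N :: H)] only if any
   supply i in the intersection already makes the rest of N useless; the
   inequality is the union bound over i. *)
Lemma hit_again N H :
  1 - (N :&: avoidable H == set0)%:R
    - \sum_(i in avoidable H)
        ((i \in N) && ((N :\ i) :&: avoidable ([set i]%SET :: H) == set0))%:R
  <= (N :&: avoidable (N :: H) != set0)%:R :> R.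
Proof.
have sum0 : 0 <= \sum_(i in avoidable H)
    ((i \in N) && ((N :\ i) :&: avoidable ([set i]%SET :: H) == set0))%:R :> R.
  by apply: sumr_ge0.
case: (eqVneq (N :&: avoidable (N :: H)) set0) => [N0|_] /=; last first.
  by have : 0 <= (N :&: avoidable H == set0)%:R :> R by []; lra.
case: (eqVneq (N :&: avoidable H) set0) => [_|/set0Pn[i]] /=; first by lra.
rewrite inE => /andP[iN iS].
rewrite (bigD1 i) //= iN (double_hit iN iS N0) eqxx /=.
suff : 0 <= \sum_(j in avoidable H | j != i)
    ((j \in N) && ((N :\ j) :&: avoidable ([set j]%SET :: H) == set0))%:R :> R by lra.
by apply: sumr_ge0.
Qed.

(** At most one summand is nonzero, as its condition says that [N] meets [avoidable H] in [i] alone;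
    [single_hit] then compares the two drops. *)
Lemma single_hit_drop N H :
  \sum_(i in avoidable H) ((i \in N) && ((N :\ i) :&: avoidable H == set0))%:R *
     (#|avoidable H|%:R - #|avoidable ([set i]%SET :: H)|%:R)
  <= #|avoidable H|%:R - #|avoidable (N :: H)|%:R :> R.
Proof.
case: (pickP (fun i => [&& i \in avoidable H, i \in N &
    (N :\ i) :&: avoidable H == set0])) => [i /and3P[iS iN iN0]|none]; last first.
  rewrite big1 ?subr_ge0 ?ler_nat ?subset_leq_card ?avoidable_cons // => i iS.
  by have := none i; rewrite iS /= => ->; rewrite mul0r.
have Ni : N :&: avoidable H = [set i]%SET.
  apply/setP => j; rewrite !inE; case: (eqVneq j i) => [->|ji].
    by rewrite iN; move: iS; rewrite inE.
  have /setP/(_ j) := eqP iN0; rewrite !inE ji /=.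
  by case: (j \in N).
have [sub _] := single_hit Ni.
rewrite (bigD1 i) //= iN iN0 mul1r big1 ?addr0.
  by rewrite lerD2l lerN2 ler_nat subset_leq_card.
move=> j /andP[jS ji]; case: (boolP (j \in N)) => jN /=; last by rewrite mul0r.
have : j \in [set i]%SET by rewrite -Ni inE jN.
by rewrite inE (negbTE ji).
Qed.

Lemma only_prob S i :
  \sum_(N : {set I}) mu N * ((i \in N) && ((N :\ i) :&: S == set0))%:R =
  \sum_y q y * (a i y * \prod_(j in S :\ i) (1 - a j y)).
Proof.
by rewrite set_law_mean; apply: eq_bigr => y _; rewrite set_law_given_only.
Qed.

(** This averages [hit_again] over [N]. If [Si i] were [S], the union bound would yield the term
    [load * expR (- load)]. The correction is the drop from [S] to [Si i]: a demand containing [i]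
    has, by [single_hit_drop], at least this effect whenever it misses the rest of [S], which has
    probability at least [delta]. *)
Lemma hit_again_prob (delta : R) H : 0 < delta -> delta <= expR (- c) - c ^+ 2 / n ->
  1 - \sum_y q y * (expR (- load y (avoidable H)) * (1 + load y (avoidable H)))
    - c / (n * delta) * \sum_(N : {set I}) mu N *
        (#|avoidable H|%:R - #|avoidable (N :: H)|%:R)
  <= \sum_(N : {set I}) mu N * (N :&: avoidable (N :: H) != set0)%:R.
Proof.
move=> d0 dle; set S := avoidable H.
pose Si i := avoidable ([set i]%SET :: H).
pose al i := \sum_y q y * a i y.
have al0 i : 0 <= al i by apply: sumr_ge0 => y _; rewrite mulr_ge0 ?(proj1 q_law).
have Sub i : Si i \subset S by exact: avoidable_cons.
have cn0 : 0 <= c / n by rewrite divr_ge0 ?ltW.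
have drop0 i : 0 <= #|S|%:R - #|Si i|%:R :> R.
  by rewrite subr_ge0 ler_nat subset_leq_card.
have term i : i \in S ->
    \sum_(N : {set I}) mu N * ((i \in N) && ((N :\ i) :&: Si i == set0))%:R <=
    \sum_y q y * (a i y * expR (- load y S)) + c / n * (al i * (#|S|%:R - #|Si i|%:R)).
  move=> iS; rewrite only_prob.
  (* The leaf at [i] saturates [i], so [i] has already left [Si i]. *)
  have iSi : Si i :\ i = Si i.
    apply/setP => j; rewrite !inE; case: eqP => //= ->; apply/esym.
    have h : [set i]%SET :&: avoidable H = [set i]%SET.
      by apply/setIidPl; rewrite sub1set.
    by have [_ /negbTE] := single_hit h; rewrite inE.
  have -> : c / n * (al i * (#|S|%:R - #|Si i|%:R)) =
      \sum_y q y * (a i y * (c / n * (#|S|%:R - #|Si i|%:R))).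
    by rewrite /al mulr_suml mulr_sumr; apply: eq_bigr => y _; ring.
  rewrite -big_split /=; apply: ler_sum => y _.
  rewrite iSi; have [_ h _] := prod_onem_expR (Si i) (fun i => a01 i y).
  have /andP[l0 l1] := load_diff y (Sub i).
  have h2 := expRN_lipschitz (load_ge0 y (Si i)) (_ : load y (Si i) <= load y S).
  have {}h2 := h2 ltac:(by rewrite -subr_ge0).
  rewrite -mulrDr; apply: ler_wpM2l; first exact: (proj1 q_law).
  rewrite -mulrDr ler_wpM2l //; apply: le_trans h _.
  rewrite -/(load y (Si i)).
  by move: l1 h2; lra.
have drop : delta * \sum_(i in S) al i * (#|S|%:R - #|Si i|%:R) <=
    \sum_(N : {set I}) mu N * (#|S|%:R - #|avoidable (N :: H)|%:R).
  apply: (@le_trans _ _ (\sum_(N : {set I}) mu N * (\sum_(i in S)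
     ((i \in N) && ((N :\ i) :&: S == set0))%:R * (#|S|%:R - #|Si i|%:R)))); last first.
    apply: ler_sum => N _; apply: ler_wpM2l; first exact: (proj1 mu_law).
    exact: single_hit_drop.
  under [leRHS]eq_bigr do rewrite mulr_sumr.
  rewrite exchange_big /= mulr_sumr; apply: ler_sum => i iS.
  under [leRHS]eq_bigr do rewrite mulrA.
  rewrite -mulr_suml only_prob mulrA; apply: ler_wpM2r => //.
  rewrite /al mulr_sumr; apply: ler_sum => y _; rewrite mulrCA; apply: ler_wpM2l.
    exact: (proj1 q_law).
  rewrite mulrC ler_wpM2l //; apply: le_trans dle _.
  have /andP[h _] := miss_prob_bounds y (S :\ i); apply: le_trans h.
  by rewrite lerD2r ler_expR lerN2 load_le.
apply: (@le_trans _ _ (\sum_(N : {set I}) mu N * (1 - (N :&: avoidable H == set0)%:R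
    - \sum_(i in avoidable H) ((i \in N) && ((N :\ i) :&: avoidable ([set i]%SET :: H) == set0))%:R)));
  last first.
  by apply: ler_sum => N _; apply: ler_wpM2l; [exact: (proj1 mu_law) | exact: hit_again].
have -> : \sum_(N : {set I}) mu N * (1 - (N :&: avoidable H == set0)%:R
    - \sum_(i in avoidable H) ((i \in N) && ((N :\ i) :&: avoidable ([set i]%SET :: H) == set0))%:R) =
   1 - \sum_y q y * \prod_(i in S) (1 - a i y) - \sum_(i in S)
    \sum_(N : {set I}) mu N * ((i \in N) && ((N :\ i) :&: Si i == set0))%:R.
  under eq_bigr do rewrite mulrBr mulrBr mulr1.
  rewrite !sumrB (proj2 mu_law) set_law_mean; congr (_ - _ - _).
    by apply: eq_bigr => y _; rewrite set_law_given_miss.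
  by rewrite exchange_big /=; apply: eq_bigr => N _; rewrite mulr_sumr.
have T : \sum_(i in S) \sum_(N : {set I}) mu N * ((i \in N) && ((N :\ i) :&: Si i == set0))%:R <=
    \sum_(i in S) (\sum_y q y * (a i y * expR (- load y S)) + c / n * (al i * (#|S|%:R - #|Si i|%:R))).
  exact: ler_sum.
have M : \sum_y q y * \prod_(i in S) (1 - a i y) <= \sum_y q y * expR (- load y S).
  apply: ler_sum => y _; apply: ler_wpM2l; first exact: (proj1 q_law).
  by have /andP[] := miss_prob_bounds y S.
have E : \sum_y q y * (expR (- load y S) * (1 + load y S)) =
    \sum_y q y * expR (- load y S) + \sum_(i in S) \sum_y q y * (a i y * expR (- load y S)).
  rewrite exchange_big -big_split /=; apply: eq_bigr => y _.
  by rewrite -mulr_sumr -mulr_suml -/(load y S); ring.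
have D : c / n * \sum_(i in S) (al i * (#|S|%:R - #|Si i|%:R)) <=
    c / (n * delta) * \sum_(N : {set I}) mu N * (#|S|%:R - #|avoidable (N :: H)|%:R).
  have -> : c / (n * delta) = c / n / delta by field; rewrite !lt0r_neq0.
  by rewrite -[leRHS]mulrA ler_wpM2l // mulrC ler_pdivlMr // mulrC.
rewrite big_split /= -mulr_sumr in T.
rewrite E; move: T M D; set u1 := \sum_(i in S) _; set u2 := \sum_(i in S) _.
set u3 := \sum_y _; set u4 := \sum_y _; set u5 := c / n * _; set u6 := c / (n * delta) * _.
by lra.
Qed.

Let e : R := c / n.

Let e01 : 0 <= e <= 1.
Proof. by rewrite divr_ge0 ?(ltW c_gt0) ?(ltW n_gt0). Qed.

Let e_gt0 : 0 < e.
Proof. by rewrite divr_gt0. Qed.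

(** It is [n] times the probability that a new demand contains [i] and no other point of [S]; by
    [single_hit] such a demand ends the avoidability of [i]. *)
Definition kill_rate i S : R :=
  n * \sum_y q y * (a i y * \prod_(j in S :\ i) (1 - a j y)).

Lemma prod01 y S : 0 <= \prod_(j in S) (1 - a j y) <= 1.
Proof. by have [-> -> _] := prod_onem_bounds S (fun i => a01 i y). Qed.

Lemma kill_rate_bounds i S : 0 <= kill_rate i S <= c.
Proof.
apply/andP; split.
  rewrite mulr_ge0 ?(ltW n_gt0) //; apply: sumr_ge0 => y _; rewrite !mulr_ge0 ?(proj1 q_law) //.
  by have /andP[] := prod01 y (S :\ i).
have -> : c = n * \sum_y q y * (c / n).
  by rewrite -mulr_suml (proj2 q_law) mul1r mulrC divfK ?lt0r_neq0.
rewrite ler_wpM2l ?(ltW n_gt0) //; apply: ler_sum => y _; rewrite ler_wpM2l ?(proj1 q_law) //.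
rewrite -[leRHS]mulr1; have /andP[? ?] := prod01 y (S :\ i).
by rewrite ler_pM.
Qed.

Lemma kill_rate_diff i (A B : {set I}) : A \subset B ->
  0 <= kill_rate i A - kill_rate i B <= c * (c / n * (#|B|%:R - #|A|%:R)).
Proof.
move=> AB; rewrite /kill_rate -mulrBr -sumrB.
have ABi : A :\ i \subset B :\ i by exact: setSD.
have d y := prod_onem_diff (fun j => a01 j y) ABi.
apply/andP; split.
  rewrite mulr_ge0 ?(ltW n_gt0) //; apply: sumr_ge0 => y _; rewrite -!mulrBr.
  by rewrite !mulr_ge0 ?(proj1 q_law) //; have /andP[] := d y.
have -> : c * (c / n * (#|B|%:R - #|A|%:R)) =
    n * \sum_y q y * (c / n * (c / n * (#|B|%:R - #|A|%:R))).
  by rewrite -mulr_suml (proj2 q_law); field; rewrite lt0r_neq0.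
rewrite ler_wpM2l ?(ltW n_gt0) //; apply: ler_sum => y _; rewrite -!mulrBr.
apply: ler_wpM2l; first exact: (proj1 q_law).
have /andP[d0 d1] := d y; apply: ler_pM => //; apply: le_trans d1 _.
have /andP[_] := load_diff y AB; apply: le_trans.
rewrite /load [X in _ <= X - _](big_setID A) /= (setIidPr AB) addrAC subrr add0r.
rewrite big_mkcond [leRHS]big_mkcond /=; apply: ler_sum => j _.
rewrite !inE; case: (eqVneq j i) => [_|_] //=; first by case: ifP.
Qed.

Lemma kill_rate_ge i S :
  n * (\sum_y q y * (a i y * expR (- load y S))) - c ^+ 3 / n <= kill_rate i S.
Proof.
have -> : c ^+ 3 / n = n * \sum_y q y * (c / n * (c ^+ 2 / n)).
  by rewrite -mulr_suml (proj2 q_law); field; rewrite lt0r_neq0.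
rewrite -mulrBr -sumrB ler_wpM2l ?(ltW n_gt0) //; apply: ler_sum => y _.
rewrite -mulrBr; apply: ler_wpM2l; first exact: (proj1 q_law).
have /andP[h _] := miss_prob_bounds y S.
have /andP[h' _] := prod_onem_diff (fun j => a01 j y) (subD1set S i).
apply: (@le_trans _ _ (a i y * (expR (- load y S) - c ^+ 2 / n))).
  rewrite mulrBr lerD2l lerN2 ler_wpM2r // divr_ge0 ?sqr_ge0 ?(ltW n_gt0) //.
by rewrite ler_wpM2l //; lra.
Qed.

(** The order of the demands is immaterial, so a demand of [t] that meets [avoidable h] in [i] alone
    may come right after [h]. It saturates [i], and later demands cannot undo this. *)
Lemma avoidable_cat_le i (t h : seq {set I}) :
  (i \in avoidable (t ++ h))%:R <=
  \prod_(N <- t) (1 - (N :&: avoidable h == [set i]%SET)%:R) :> R.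
Proof.
case: (boolP (i \in _)) => ih; last first.
  by apply: prodr_ge0 => N _; case: eqP; rewrite ?subrr ?subr0.
rewrite big1_seq // => N /= Nt; case: eqP => [hN|_]; last by rewrite subr0.
have [_ /negP[]] := single_hit hN.
have -> // : avoidable (t ++ h) \subset avoidable (N :: h) -> i \in avoidable (N :: h).
  by move/subsetP; apply.
case/splitPr: Nt => t1 t2.
rewrite (@perm_avoidable _ _ ((t1 ++ t2) ++ N :: h)); first exact: avoidable_cat.
by rewrite -!catA perm_cat2l cat_cons -cat_rcons -cat_cons perm_cat2r perm_sym perm_rcons.
Qed.

(* Call a demand touched with probability e = c/n, in such a way that untouched
   demands are not adjacent to i and are distributed as if i did not exist.
   If i stays avoidable, no touched demand N may meet the avoidable set of the
   untouched ones in i alone. *)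
Lemma avoidable_prob_le m i :
  iid_mean mu m (fun H => (i \in avoidable H)%:R) <=
  bin_mean e m (fun k l => iid_mean mu l
    (fun H => (1 - kill_rate i (avoidable H) / c) ^+ k)).
Proof.
pose al := deleted_law q a i.
pose be N := (mu N - (1 - e) * al N) / e.
pose g N H : R := 1 - (N :&: avoidable H == [set i]%SET)%:R.
have e0 : e != 0 by rewrite lt0r_neq0.
have al0 N : 0 <= al N by exact: deleted_law_ge0.
have be0 N : 0 <= be N.
  rewrite divr_ge0 ?(ltW e_gt0) // subr_ge0; apply: deleted_law_le => //; exact: a_le.
have mu_split N : mu N = (1 - e) * al N + e * be N.
  by rewrite /be [e * _]mulrC divfK // addrC subrK.
have al1 : \sum_N al N = 1.
  rewrite -(proj2 mu_law); under eq_bigr do rewrite -[al _]mulr1.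
  by rewrite deleted_law_mean; apply: eq_bigr => N _; rewrite mulr1.
have := @iid_mean_split_le R _ mu al be e (fun H => (i \in avoidable H)%:R) g m
  e01 al0 be0 mu_split.
move=> /(_ _ _ _)/le_trans; apply.
- by move=> H H' /perm_avoidable ->.
- by move=> N H H' /perm_avoidable hH; rewrite /g hH.
- by move=> t h; exact: avoidable_cat_le.
apply: ler_bin_mean => // k l _.
rewrite (iid_mean_map (mu := mu) (h := fun N => N :\ i)); last first.
  by move=> F; rewrite deleted_law_mean.
apply: ler_iid_mean => // H _; set h := map _ _.
have ih : i \in avoidable h.
  by apply: avoidable_isolated => _ /mapP[N _ ->]; rewrite !inE eqxx.
have onlyE N : (N :&: avoidable h == [set i]%SET) =
    (i \in N) && ((N :\ i) :&: avoidable h == set0).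
  apply/eqP/andP => [hN|[iN /eqP hN]].
    have iN : i \in N by have := set11 i; rewrite -hN inE => /andP[].
    rewrite iN -subset0; split=> //; apply/subsetP => j; rewrite !inE => /andP[/andP[ji jN] jh].
    have : j \in [set i]%SET by rewrite -hN !inE jN.
    by rewrite inE (negbTE ji).
  apply/setP => j; rewrite !inE; case: (eqVneq j i) => [->|ji].
    by rewrite iN; move: ih; rewrite inE.
  have /setP/(_ j) := hN; rewrite !inE ji /=.
  by case: (j \in N).
(* The law [al] gives no mass to sets containing [i], so on these [be] is [mu / e]. With
   [e = c / n], a touched demand meets [avoidable h] in [i] alone with probability
   [kill_rate / c]. *)
have -> : \sum_N be N * g N h = 1 - kill_rate i (avoidable h) / c.
  have -> : kill_rate i (avoidable h) / c =
      e^-1 * \sum_(N : {set I}) mu N * ((i \in N) && ((N :\ i) :&: avoidable h == set0))%:R.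
    by rewrite only_prob /kill_rate /e; field; rewrite !lt0r_neq0.
  rewrite [X in _ = X - _](_ : 1 = e^-1 * (\sum_N mu N - (1 - e) * \sum_N al N)); last first.
    by rewrite al1 (proj2 mu_law); field.
  rewrite -mulrBr mulr_sumr -!sumrB mulr_sumr; apply: eq_bigr => N _.
  rewrite /be /g onlyE; case: (boolP (i \in N)) => iN /=; last first.
    by rewrite !mulr0 !subr0 mulr1 mulrC.
  have -> : al N = 0 by rewrite /al /deleted_law big1 // => y _; rewrite iN mul0r mulr0.
  by ring.
have /andP[k0 k1] := kill_rate_bounds i (avoidable h).
have /andP[k0' k1'] := kill_rate_bounds i (avoidable H).
have le1 x : x <= c -> 0 <= 1 - x / c by move=> xc; rewrite subr_ge0 ler_pdivrMr // mul1r.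
rewrite lerXn2r ?nnegrE ?le1 // lerD2l lerN2 ler_wpM2r ?invr_ge0 ?(ltW c_gt0) //.
(* Restoring [i] in the demands can only enlarge the avoidable set outside [i], and [kill_rate i] is
   nonincreasing in the set and ignores [i]. *)
have sub : avoidable h :\ i \subset avoidable H by exact: avoidable_remove.
rewrite /kill_rate; apply: ler_wpM2l; first exact: ltW.
apply: ler_sum => y _; apply: ler_wpM2l; first exact: (proj1 q_law).
apply: ler_wpM2l => //.
have sub' : avoidable h :\ i \subset avoidable H :\ i.
  by rewrite subsetD1 sub !inE eqxx.
by have /andP[] := prod_onem_diff (fun j => a01 j y) sub'; rewrite subr_ge0.
Qed.

Definition mean_avoidable m : R := iid_mean mu m (fun H => #|avoidable H|%:R).

Lemma mean_avoidable_noninc m m' : (m <= m')%N -> mean_avoidable m' <= mean_avoidable m.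
Proof.
move=> mm'; rewrite -(subnK mm') -lerN2 /mean_avoidable -!iid_meanN.
apply: ler_iid_mean_add => // N H; rewrite lerN2 ler_nat.
exact/subset_leq_card/avoidable_cons.
Qed.

Lemma mean_avoidable_bounds m : 0 <= mean_avoidable m <= n.
Proof.
apply/andP; split.
  by rewrite -(iid_mean_cst mu_law m 0); apply: ler_iid_mean.
rewrite -[leRHS](iid_mean_cst mu_law m); apply: ler_iid_mean => // H _.
exact: card_set_le.
Qed.

Lemma exp_diff_le (x y : R) k : 0 <= y -> y <= x -> x <= 1 ->
  x ^+ k - y ^+ k <= k%:R * (x - y).
Proof.
move=> y0 yx x1; elim: k => [|k IH]; first by rewrite !expr0 subrr mul0r.
have xk : 0 <= x ^+ k <= 1 by rewrite exprn_ge0 ?exprn_ile1 //; lra.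
have xyk : y ^+ k <= x ^+ k by rewrite lerXn2r ?nnegrE //; lra.
rewrite !exprS -natr1; move: (x ^+ k) (y ^+ k) (k%:R) xk xyk IH => A B K /andP[A0 A1] BA IH.
by nra.
Qed.

(** When [k] demands are touched, [p.+1 - k] are not. Replacing these by [p] draws is cheap if
    [mean_avoidable] hardly varies over the last [k0] draws. The number [k] is then independent of
    the avoidable set, and the binomial generating function gives the exponential. *)
Lemma avoidable_prob_le_exp p k0 i : (0 < k0 <= p.+1)%N -> n <= p.+1%:R ->
  iid_mean mu p.+1 (fun H => (i \in avoidable H)%:R) <=
  iid_mean mu p (fun H => expR (- kill_rate i (avoidable H))) +
  p.+1%:R * e * (e * (mean_avoidable (p.+1 - k0) - mean_avoidable p.+1) + k0%:R^-1).
Proof.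
case/andP=> k0_gt0 k0_le np; apply: le_trans (avoidable_prob_le _ _) _.
set K := (X in _ * _ * X).
pose x H := 1 - kill_rate i (avoidable H) / c.
have x01 H : 0 <= x H <= 1.
  have /andP[? ?] := kill_rate_bounds i (avoidable H).
  by rewrite subr_ge0 ler_pdivrMr // mul1r lerBlDr lerDl divr_ge0 ?(ltW c_gt0) // andbT.
have K0 : 0 <= e * (mean_avoidable (p.+1 - k0) - mean_avoidable p.+1).
  rewrite mulr_ge0 ?(ltW e_gt0) // subr_ge0; apply: mean_avoidable_noninc; exact: leq_subr.
have k0R : 0 < k0%:R :> R by rewrite ltr0n.
have step k l : (k + l)%N = p.+1 ->
    iid_mean mu l (fun H => x H ^+ k) <= iid_mean mu p (fun H => x H ^+ k) + k%:R * K.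
  move=> kl; case: k kl => [|k] kl.
    by rewrite mul0r addr0 !iid_mean_cst.
  (* As in Markov's inequality, beyond [k0] touched demands the term [k.+1 / k0] is at least 1 and
     the bound is trivial. *)
  case: (leqP k.+1 k0) => kk0; last first.
    apply: (@le_trans _ _ (0 + k.+1%:R * k0%:R^-1)).
      apply: (@le_trans _ _ 1).
        rewrite -[leRHS](iid_mean_cst mu_law l); apply: ler_iid_mean => // H _.
        by have /andP[? ?] := x01 H; rewrite exprn_ile1.
      by rewrite add0r ler_pdivlMr // mul1r ler_nat ltnW.
    apply: lerD; last by rewrite ler_wpM2l // /K lerDr.
    rewrite -(iid_mean_cst mu_law p 0); apply: ler_iid_mean => // H _.
    by have /andP[? ?] := x01 H; rewrite exprn_ge0.
  have lp : (l <= p)%N by move: kl; rewrite addSn => -[<-]; exact: leq_addl.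
  (* A new demand lowers [x H ^+ k.+1] by at most [k.+1 * e] times the drop in [#|avoidable H|], so
     this difference is nondecreasing in the list. *)
  have mono : iid_mean mu l (fun H => x H ^+ k.+1 - k.+1%:R * e * #|avoidable H|%:R) <=
      iid_mean mu p (fun H => x H ^+ k.+1 - k.+1%:R * e * #|avoidable H|%:R).
    rewrite -(subnK lp); apply: ler_iid_mean_add => // N H.
    have sub : avoidable (N :: H) \subset avoidable H by exact: avoidable_cons.
    have /andP[d0 d1] := kill_rate_diff i sub.
    have dx : x H - x (N :: H) = (kill_rate i (avoidable (N :: H)) - kill_rate i (avoidable H)) / c.
      by rewrite /x; field; rewrite lt0r_neq0.
    have /andP[xH0 xH1] := x01 H; have /andP[xN0 xN1] := x01 (N :: H).
    have xle : x (N :: H) <= x H by rewrite -subr_ge0 dx divr_ge0 ?(ltW c_gt0).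
    have := exp_diff_le k.+1 xN0 xle xH1.
    have : k.+1%:R * (x H - x (N :: H)) <=
        k.+1%:R * (e * (#|avoidable H|%:R - #|avoidable (N :: H)|%:R)).
      by rewrite ler_wpM2l // dx ler_pdivrMr // mulrC.
    move: (x H ^+ _) (x (N :: H) ^+ _) => A B; lra.
  move: mono; rewrite !iid_meanB !iid_meanZ -/(mean_avoidable l) -/(mean_avoidable p).
  have hl : mean_avoidable l <= mean_avoidable (p.+1 - k0).
    by apply: mean_avoidable_noninc; rewrite leq_subLR -kl leq_add2r.
  have hp : mean_avoidable p.+1 <= mean_avoidable p by exact: mean_avoidable_noninc.
  have : k.+1%:R * (e * (mean_avoidable l - mean_avoidable p)) <= k.+1%:R * K.
    rewrite ler_wpM2l // /K; apply: (@le_trans _ _ (e * (mean_avoidable (p.+1 - k0) - mean_avoidable p.+1))).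
      by rewrite ler_wpM2l ?(ltW e_gt0) //; lra.
    by rewrite lerDl invr_ge0 ltW.
  move: (iid_mean mu l _) (iid_mean mu p _) => A B; lra.
apply: le_trans (ler_bin_mean e01 step) _.
rewrite bin_meanD (bin_mean_iid_mean mu e p.+1 p (fun k _ H => x H ^+ k)).
have -> : bin_mean e p.+1 (fun k _ => k%:R * K) = p.+1%:R * e * K.
  by rewrite -bin_mean_id mulrC -bin_meanZ; apply: eq_bin_mean => k l _; rewrite mulrC.
rewrite lerD2r; apply: ler_iid_mean => // H _; rewrite bin_mean_exp.
have -> : 1 - e + e * x H = 1 - kill_rate i (avoidable H) / n.
  by rewrite /x /e; field; rewrite !lt0r_neq0.
have /andP[k0' k1] := kill_rate_bounds i (avoidable H).
have kn : 0 <= 1 - kill_rate i (avoidable H) / n.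
  by rewrite subr_ge0 ler_pdivrMr // mul1r (le_trans k1).
apply: (@le_trans _ _ (expR (- (kill_rate i (avoidable H) / n)) ^+ p.+1)).
  by rewrite lerXn2r ?nnegrE ?expR_ge0 // expR_ge1Dx.
rewrite -expRM_natl ler_expR -mulNr mulrCA mulNr lerN2 ler_peMr //.
by rewrite ler_pdivlMr // mul1r.
Qed.

(* This is n (1 - F), for the empirical supply types, where M_y t_y = load y S. *)
Definition cover_profile S : R :=
  n - \sum_i expR (- (n * \sum_y q y * (a i y * expR (- load y S))))
  + n * (1 - \sum_y q y * (expR (- load y S) * (1 + load y S))).

(** By [rank_hullE] the mean rank is [n - mean_avoidable] plus the mean number of demands meeting
    the avoidable set. The former is bounded by [avoidable_prob_le_exp] summed over supplies, the
    latter by [iid_mean_count] and [hit_again_prob], both in terms of [p] demands. The factors 2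
    come from [p.+1 <= 2 * n]. *)
Lemma rank_mean_ge_at (delta D : R) p k0 : 0 < delta -> delta <= expR (- c) - c ^+ 2 / n ->
  (0 < k0 <= p.+1)%N -> n <= p.+1%:R -> p.+1%:R <= 2 * n ->
  mean_avoidable (p.+1 - k0) - mean_avoidable p.+1 = D ->
  iid_mean mu p (fun H => cover_profile (avoidable H))
    - (c ^+ 3 + n * (2 * c * (c / n * D + k0%:R^-1)) + 2 * c / delta * D)
  <= iid_mean mu p.+1 (fun H => (rank H)%:R).
Proof.
move=> d0 dle k0p np pn DE.
pose f H := \sum_i expR (- (n * \sum_y q y * (a i y * expR (- load y (avoidable H))))).
pose g H := 1 - \sum_y q y * (expR (- load y (avoidable H)) * (1 + load y (avoidable H))).
have D0 : 0 <= D by rewrite -DE subr_ge0; apply: mean_avoidable_noninc; exact: leq_subr.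
have k0R : 0 <= k0%:R^-1 :> R by rewrite invr_ge0.
have sumE : mean_avoidable p.+1 = \sum_i iid_mean mu p.+1 (fun H => (i \in avoidable H)%:R).
  rewrite -iid_mean_sum; apply: eq_iid_mean => H _.
  by rewrite -sum1_card natr_sum big_mkcond; apply: eq_bigr => i _; case: (i \in _).
have saturated : mean_avoidable p.+1 <=
    iid_mean mu p f + (c ^+ 3 + n * (2 * c * (c / n * D + k0%:R^-1))).
  rewrite sumE.
  apply: (@le_trans _ _ (\sum_i (iid_mean mu p (fun H =>
     expR (- (n * \sum_y q y * (a i y * expR (- load y (avoidable H)))))) +
     (c ^+ 3 / n + 2 * c * (c / n * D + k0%:R^-1))))).
    apply: ler_sum => i _; apply: le_trans (avoidable_prob_le_exp i k0p np) _.
    rewrite DE addrA; apply: lerD.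
      rewrite -[X in _ + X](iid_mean_cst mu_law p) -iid_meanD.
      apply: ler_iid_mean => // H _.
      have := kill_rate_ge i (avoidable H); have /andP[k_ge0 _] := kill_rate_bounds i (avoidable H).
      set la := n * _ => kla; have c3 : 0 <= c ^+ 3 / n by rewrite divr_ge0 ?exprn_ge0 ?(ltW c_gt0) ?(ltW n_gt0).
      case: (leP la (kill_rate i (avoidable H))) => h.
        by apply: ler_wpDr => //; rewrite ler_expR lerN2.
      have := expRN_lipschitz k_ge0 (ltW h).
      move: (expR _) (expR _) => A B; lra.
    apply: ler_wpM2r.
      by rewrite addr_ge0 // mulr_ge0 // divr_ge0 ?(ltW c_gt0) ?(ltW n_gt0).
    by rewrite /e mulrA ler_pdivrMr // mulrAC ler_wpM2r ?(ltW c_gt0).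
  rewrite big_split /= iid_mean_sum lerD2l sum_cst mulrDl divfK ?lt0r_neq0 //.
  by rewrite lerD2l [X in _ <= X]mulrC.
have again : n * iid_mean mu p g - 2 * c / delta * D <=
   iid_mean mu p.+1 (fun H => \sum_(N <- H) (N :&: avoidable H != set0)%:R).
  rewrite (iid_mean_count mu p (psi := fun N H => (N :&: avoidable H != set0)%:R)); last first.
    by move=> N H H' /perm_avoidable ->.
  apply: (@le_trans _ _ (p.+1%:R * iid_mean mu p (fun H => g H - c / (n * delta) *
     \sum_(N : {set I}) mu N * (#|avoidable H|%:R - #|avoidable (N :: H)|%:R)))); last first.
    rewrite ler_wpM2l //; apply: ler_iid_mean => // H _; exact: hit_again_prob.
  rewrite (iid_meanB mu p g) iid_meanZ mulrBr; apply: lerD.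
    apply: ler_wpM2r => //; rewrite -(iid_mean_cst mu_law p 0).
    apply: ler_iid_mean => // H _; rewrite subr_ge0 -(proj2 q_law).
    apply: ler_sum => y _; rewrite -[leRHS]mulr1 ler_wpM2l ?(proj1 q_law) //.
    rewrite (proj2 q_law).
    have := load_ge0 y (avoidable H); move: (load _ _) => x x0.
    rewrite expRN mulrC ler_pdivrMr ?expR_gt0 // mul1r; exact: expR_ge1Dx.
  rewrite lerN2.
  have -> : iid_mean mu p (fun H => \sum_(N : {set I}) mu N *
        (#|avoidable H|%:R - #|avoidable (N :: H)|%:R)) = mean_avoidable p - mean_avoidable p.+1.
    transitivity (iid_mean mu p (fun H => #|avoidable H|%:R -
        \sum_(N : {set I}) mu N * #|avoidable (N :: H)|%:R)).
      apply: eq_iid_mean => H _; under eq_bigr do rewrite mulrBr.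
      by rewrite sumrB -mulr_suml (proj2 mu_law) mul1r.
    rewrite iid_meanB iid_mean_sum; congr (_ - _); apply: eq_bigr => N _.
    by rewrite iid_meanZ.
  have DD : mean_avoidable p - mean_avoidable p.+1 <= D.
    rewrite -DE lerD2r; apply: mean_avoidable_noninc; rewrite leq_subLR -addn1 addnC leq_add2r.
    by case/andP: k0p.
  have Dp : 0 <= mean_avoidable p - mean_avoidable p.+1.
    by rewrite subr_ge0; apply: mean_avoidable_noninc.
  rewrite mulrA; apply: ler_pM => //.
    by rewrite mulr_ge0 // divr_ge0 ?(ltW c_gt0) // mulr_ge0 ?(ltW n_gt0) ?(ltW d0).
  have -> : 2 * c / delta = 2 * n * (c / (n * delta)).
    by field; rewrite !lt0r_neq0.
  by rewrite ler_wpM2r // divr_ge0 ?(ltW c_gt0) // mulr_ge0 ?(ltW n_gt0) ?(ltW d0).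
have -> : iid_mean mu p.+1 (fun H => (rank H)%:R) = n - mean_avoidable p.+1 +
    iid_mean mu p.+1 (fun H => \sum_(N <- H) (N :&: avoidable H != set0)%:R).
  rewrite -[X in X - _](iid_mean_cst mu_law p.+1) -iid_meanB -iid_meanD.
  apply: eq_iid_mean => H _; rewrite rank_hullE natrD card_hull natrB ?max_card //.
  congr (_ + _); rewrite -sum1_count natr_sum big_mkcond; apply: eq_bigr => N _.
  by case: (_ == _).
have -> : iid_mean mu p (fun H => cover_profile (avoidable H)) =
    n - iid_mean mu p f + n * iid_mean mu p g.
  rewrite -[X in X - _](iid_mean_cst mu_law p) -iid_meanZ -iid_meanB -iid_meanD.
  exact: eq_iid_mean.
move: saturated again; move: (iid_mean mu p.+1 _) (iid_mean mu p f) (n * iid_mean mu p g).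
by move=> A B C; lra.
Qed.

(* Pigeonhole: the mean number of avoidable supplies decreases by at most n in
   total. *)
Lemma slow_step (k0 B : nat) : (0 < B)%N -> exists2 b, (b < B)%N &
  mean_avoidable (#|I| + b * k0) - mean_avoidable (#|I| + b.+1 * k0) <= n / B%:R.
Proof.
move=> B0; set u := fun b => - mean_avoidable (#|I| + b * k0).
case: (boolP [exists b : 'I_B, u b.+1 - u b <= n / B%:R]) => [/existsP[b hb]|].
  by exists b => //; move: hb; rewrite /u opprK addrC.
rewrite negb_exists => /forallP hlt; exfalso.
have : n < u B - u 0%N.
  rewrite -telescope_sumr // big_mkord.
  apply: (@le_lt_trans _ _ (\sum_(b < B) n / B%:R)).
    by rewrite sumr_const card_ord -[n / _ *+ _]mulr_natr divfK // pnatr_eq0 -lt0n.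
  apply: ltr_sum => [|b _]; last by rewrite ltNge.
  by apply/hasP; exists (Ordinal B0); rewrite ?mem_index_enum.
have /andP[_] := mean_avoidable_bounds (#|I| + 0 * k0).
have /andP[+ _] := mean_avoidable_bounds (#|I| + B * k0).
by rewrite /u; lra.
Qed.

(** Within [k0 * B] demands beyond [n], [slow_step] finds a window of [k0] demands where the mean
    avoidable number falls by at most [n / B]. The bound is applied there, and discarding the extra
    demands lowers the rank by at most their number. *)
Lemma rank_mean_ge (delta L : R) (k0 B : nat) :
  0 < delta -> delta <= expR (- c) - c ^+ 2 / n ->
  (0 < k0)%N -> (0 < B)%N -> (k0 * B <= #|I|)%N ->
  (forall S, L <= cover_profile S) ->
  L - (c ^+ 3 + n * (2 * c * (c / B%:R + k0%:R^-1)) + 2 * c / delta * (n / B%:R)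
       + (k0 * B)%:R)
  <= iid_mean mu #|I| (fun H => (rank H)%:R).
Proof.
move=> d0 dle k00 B0 kB hL; have [b bB hb] := slow_step k0 B0.
have I0 : (0 < #|I|)%N by rewrite -(ltr0n R).
(* The right end of the window is [p.+1], and [p.+1 - k0] is its left end. *)
pose p := (#|I| + b.+1 * k0).-1.
have pE : p.+1 = (#|I| + b.+1 * k0)%N by rewrite prednK // addn_gt0 I0.
have bk : (b.+1 * k0 <= k0 * B)%N by rewrite mulnC leq_pmul2l.
have pk : (p.+1 - k0 = #|I| + b * k0)%N by rewrite pE mulSn addnCA addKn.
have := @rank_mean_ge_at delta _ p k0 d0 dle; rewrite pk pE k00 /=.
have -> : (k0 <= #|I| + b.+1 * k0)%N by rewrite mulSn addnCA leq_addr.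
have np : n <= (#|I| + b.+1 * k0)%:R by rewrite ler_nat leq_addr.
have pn : (#|I| + b.+1 * k0)%:R <= 2 * n.
  by rewrite /n -natrM ler_nat mul2n -addnn leq_add2l (leq_trans bk).
move: hb; set D := _ - _ => hb /(_ _ isT np pn erefl).
have prof : L <= iid_mean mu p (fun H => cover_profile (avoidable H)).
  by rewrite -(iid_mean_cst mu_law p L); apply: ler_iid_mean.
have /andP[_] := rank_mean_lipschitz #|I| (b.+1 * k0); rewrite addnC.
have bkR : (b.+1 * k0)%:R <= (k0 * B)%:R :> R by rewrite ler_nat.
have h1 : n * (2 * c * (c / n * D + k0%:R^-1)) <= n * (2 * c * (c / B%:R + k0%:R^-1)).
  rewrite ler_wpM2l ?(ltW n_gt0) // ler_wpM2l ?mulr_ge0 ?(ltW c_gt0) // lerD2r.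
  apply: (@le_trans _ _ (c / n * (n / B%:R))); first by rewrite ler_wpM2l ?(ltW e_gt0).
  by rewrite mulrA divfK ?lt0r_neq0.
have h2 : 2 * c / delta * D <= 2 * c / delta * (n / B%:R).
  by rewrite ler_wpM2l // divr_ge0 ?(ltW d0) // mulr_ge0 ?(ltW c_gt0).
move: prof h1 h2; move: (iid_mean _ _ _) (iid_mean _ _ _) (iid_mean _ _ _).
by move=> A A' A''; lra.
Qed.

End RankMean.

(** * The random compatibility graph *)

Section CompatibilityGraph.
Local Open Scope classical_set_scope.
Local Open Scope ring_scope.
Variables (R : realType) (bL bR : R) (C : 'M[R]_2).
Hypotheses (hbL : 0 <= bL <= 1) (hbR : 0 <= bR <= 1) (hC : forall x y, 0 <= C x y).

Let p := type_prob bL.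
Let q := type_prob bR.
Let M := demand_mean bL C.
Let F := matching_F bL bR C.

(* The summand 1 keeps the bound positive when C = 0. *)
Definition intensity_bound : R := 1 + \sum_(x < 2) \sum_(y < 2) C x y.
Let c := intensity_bound.

Definition edge_prob n (u : 'I_n -> 'I_2) (i : 'I_n) (y : 'I_2) : R := C (u i) y / n%:R.

Definition flexible_count n (u : 'I_n -> 'I_2) : R := \sum_i (u i != ord0)%:R.

Lemma C_le_bound x y : C x y <= c.
Proof.
rewrite /c /intensity_bound (bigD1 x) //= (bigD1 y) //=.
have : 0 <= \sum_(i < 2 | i != y) C x i by apply: sumr_ge0.
have : 0 <= \sum_(i < 2 | i != x) \sum_(j < 2) C i j.
  by apply: sumr_ge0 => i _; apply: sumr_ge0.
by lra.
Qed.

Lemma bound_gt0 : 0 < c.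
Proof.
have : 0 <= \sum_(i < 2) \sum_(j < 2) C i j.
  by apply: sumr_ge0 => i _; apply: sumr_ge0.
by rewrite /c /intensity_bound; lra.
Qed.

Lemma is_law_type_prob (b : R) : 0 <= b <= 1 -> is_law (type_prob b).
Proof.
case/andP=> b0 b1; split=> [x|].
  by rewrite /type_prob; case: eqP; rewrite ?subr_ge0.
by rewrite big_ord_recr big_ord1 /type_prob /= subrK.
Qed.

Let q_law : is_law q := is_law_type_prob hbR.

Lemma mean_type_prob (b : R) (phi : 'I_2 -> R) :
  \sum_(x < 2) type_prob b x * phi x = phi ord0 + b * (phi ord_max - phi ord0).
Proof.
rewrite big_ord_recr big_ord1 /type_prob /=.
have -> : widen_ord (leqnSn 1) ord0 = ord0 :> 'I_2 by apply: val_inj.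
by ring.
Qed.

(** With two types, such a sum is affine in the number of flexible supplies, so the empirical types
    enter below only through [flexible_count]. *)
Lemma sum_types n (u : 'I_n -> 'I_2) (phi : 'I_2 -> R) :
  \sum_i phi (u i) = n%:R * (\sum_x p x * phi x)
    + (flexible_count u - n%:R * bL) * (phi ord_max - phi ord0).
Proof.
transitivity (\sum_(i < n) (phi ord0 + (u i != ord0)%:R * (phi ord_max - phi ord0))).
  apply: eq_bigr => i _; case: (eqVneq (u i) ord0) => [->|ui] /=; first by ring.
  have -> : u i = ord_max by apply: val_inj; move: ui; case: (u i) => [[|[|]]].
  by ring.
rewrite big_split /= sumr_const card_ord -mulr_suml -mulr_natl mean_type_prob.
by rewrite -/(flexible_count u); ring.
Qed.

Lemma sum_types_le n (u : 'I_n -> 'I_2) (phi : 'I_2 -> R) (B : R) :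
  (forall x, 0 <= phi x <= B) ->
  `|\sum_i phi (u i) - n%:R * (\sum_x p x * phi x)|
    <= `|flexible_count u - n%:R * bL| * B.
Proof.
move=> hphi; rewrite sum_types addrAC subrr add0r normrM ler_wpM2l //.
have /andP[? ?] := hphi ord0; have /andP[? ?] := hphi ord_max.
by rewrite ler_norml; apply/andP; split; lra.
Qed.

Lemma M_ge0 y : 0 <= M y.
Proof.
apply: sumr_ge0 => x _; rewrite mulr_ge0 //; exact: (proj1 (is_law_type_prob hbL)).
Qed.

(** The Poisson probability that a supply of type [x] is the sole avoidable neighbour of no demand,
    when a demand of type [y] has on average [T y] avoidable neighbours. *)
Definition supply_free_prob (T : 'I_2 -> R) (x : 'I_2) : R :=
  expR (- \sum_y C x y * q y * expR (- T y)).

Lemma matching_F_free t : 1 - F t =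
  \sum_x p x * (1 - supply_free_prob (fun y => M y * t y) x)
  + \sum_y q y * (1 - expR (- (M y * t y)) * (1 + M y * t y)).
Proof.
rewrite /F /matching_F /supply_free_prob -/p -/q -/M.
under [X in _ = X + _]eq_bigr do rewrite mulrBr mulr1.
under [X in _ = _ + X]eq_bigr do rewrite mulrBr mulr1 mulrA.
rewrite !sumrB (proj2 q_law) (proj2 (is_law_type_prob hbL)).
by ring.
Qed.

Lemma supply_free_prob01 T x : 0 <= supply_free_prob T x <= 1.
Proof.
rewrite expR_ge0 /= expR_le1 oppr_le0; apply: sumr_ge0 => y _.
by rewrite !mulr_ge0 ?expR_ge0 //; exact: (proj1 q_law).
Qed.

(** * Comparison with [F] for given supply types *)

Section FixedTypes.
Variables (n : nat) (u : 'I_n -> 'I_2).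
Hypotheses (n_gt0 : (0 < n)%N) (c_le : c <= n%:R).

Let a := edge_prob u.
Let mean_rank := iid_mean (set_law q a) n (fun H => (rank H)%:R).
Let nR : 0 < #|'I_n|%:R :> R.
Proof. by rewrite card_ord ltr0n. Qed.
Let dev := `|flexible_count u - n%:R * bL|.

Lemma edge_prob_ge0 i y : 0 <= a i y.
Proof. by rewrite divr_ge0. Qed.

Lemma edge_prob_le i y : a i y <= c / #|'I_n|%:R.
Proof. by rewrite card_ord ler_wpM2r ?invr_ge0 // C_le_bound. Qed.

Let c_le' : c <= #|'I_n|%:R.
Proof. by rewrite card_ord. Qed.

Lemma supply_rate_E (T : 'I_2 -> R) i :
  expR (- (n%:R * \sum_y q y * expR (- T y) * a i y)) = supply_free_prob T (u i).
Proof.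
rewrite /supply_free_prob; congr (expR (- _)); rewrite mulr_sumr.
apply: eq_bigr => y _; rewrite /a /edge_prob; field.
by rewrite lt0r_neq0 // ltr0n.
Qed.

Lemma mean_rank_upper (t : 'I_2 -> R) (s : R) : (forall y, 0 <= t y) -> 0 < s ->
  mean_rank <= n%:R * (1 - F t) + dev + (2 * c ^+ 2 + s / 2 + n%:R / (2 * s)).
Proof.
move=> t0 s0; rewrite /mean_rank.
have T0 y : 0 <= M y * t y by rewrite mulr_ge0 ?M_ge0.
have := rank_mean_le q_law edge_prob_ge0 edge_prob_le nR bound_gt0 c_le' T0 s0.
rewrite card_ord.
rewrite (eq_bigr (fun i => 1 - supply_free_prob (fun y => M y * t y) (u i))); last first.
  by move=> i _; rewrite supply_rate_E.
move=> /le_trans; apply; rewrite lerD2r matching_F_free mulrDr.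
rewrite [leRHS]addrAC [leRHS]addrC lerD2l.
have := sum_types_le u (phi := fun x => 1 - supply_free_prob (fun y => M y * t y) x) (B := 1).
rewrite mulr1 -/dev => /(_ _)/ler_normlW h.
rewrite -lerBlDl; apply: h => x.
by have /andP[? ?] := supply_free_prob01 (fun y => M y * t y) x; lra.
Qed.

(** The loads of [S] may exceed [M y], which is computed from the exact type probabilities. Capping
    them at [M y] moves them by at most [c * dev / n] and makes them of the form [M y * t y] with
    [t y] in [0,1], where [F t <= m] applies. *)
Lemma cover_profile_lower (m : R) S :
  (forall t : 'I_2 -> R, (forall y, 0 <= t y <= 1) -> F t <= m) ->
  n%:R * (1 - m) - (1 + c ^+ 2) * dev <= cover_profile q a S.
Proof.
move=> hm.
have n0 : 0 < n%:R :> R by rewrite ltr0n.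
have c0 := ltW bound_gt0.
have dev0 : 0 <= dev by exact: normr_ge0.
pose tau y := load a y S.
have tau0 y : 0 <= tau y by apply: load_ge0 => *; exact: edge_prob_ge0.
have tauM y : tau y <= M y + c * (dev / n%:R).
  apply: (@le_trans _ _ (\sum_i a i y)).
    rewrite /tau /load big_mkcond /=; apply: ler_sum => i _.
    by case: ifP => // _; exact: edge_prob_ge0.
  have := sum_types_le u (phi := fun x => C x y) (B := c).
  move=> /(_ _)/ler_normlW h; rewrite /a /edge_prob -mulr_suml ler_pdivrMr //.
  rewrite mulrDl mulrA divfK ?lt0r_neq0 // -lerBlDl [c * _]mulrC.
  have -> : M y * n%:R = n%:R * \sum_x p x * C x y.
    rewrite mulrC; congr (_ * _); rewrite /M /demand_mean.
    by apply: eq_bigr => x _; rewrite mulrC.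
  by apply: h => x; rewrite hC C_le_bound.
pose tau' y := Num.min (tau y) (M y).
(* If M y = 0 the division gives t y = 0. *)
pose t y := tau' y / M y.
have tau'0 y : 0 <= tau' y by rewrite le_min tau0 M_ge0.
have tau'M y : tau' y <= M y by rewrite ge_min lexx orbT.
have Mt y : M y * t y = tau' y.
  rewrite /t; have [M0|M0] := eqVneq (M y) 0.
    by have := tau'M y; have := tau'0 y; rewrite M0 mul0r; lra.
  by rewrite mulrC divfK.
have t01 y : 0 <= t y <= 1.
  rewrite /t divr_ge0 ?M_ge0 //=; have [->|M0] := eqVneq (M y) 0.
    by rewrite invr0 mulr0.
  by rewrite ler_pdivrMr ?mul1r // lt0r M0 M_ge0.
have tau'le y : tau' y <= tau y by rewrite ge_min lexx.
have taule y : tau y - tau' y <= c * (dev / n%:R).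
  rewrite /tau'; case: (leP (tau y) (M y)) => _.
    by rewrite subrr mulr_ge0 ?divr_ge0 // ltW.
  by have := tauM y; lra.
have free x : supply_free_prob tau x <= supply_free_prob tau' x + c ^+ 2 * (dev / n%:R).
  rewrite -lerBlDl.
  have A0 T : 0 <= \sum_y C x y * q y * expR (- T y).
    by apply: sumr_ge0 => y _; rewrite !mulr_ge0 ?expR_ge0 //; exact: (proj1 q_law).
  case: (leP (\sum_y C x y * q y * expR (- tau y)) (\sum_y C x y * q y * expR (- tau' y))) => [h|/ltW h].
    apply: le_trans (expRN_lipschitz (A0 tau) h) _; rewrite -sumrB.
    have -> : c ^+ 2 * (dev / n%:R) = \sum_y q y * (c * (c * (dev / n%:R))).
      by rewrite -mulr_suml (proj2 q_law); ring.
    apply: ler_sum => y _; rewrite -mulrBr [C x y * q y]mulrC -mulrA.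
    apply: ler_wpM2l; first exact: (proj1 q_law).
    have e0 : 0 <= expR (- tau' y) - expR (- tau y) by rewrite subr_ge0 ler_expR lerN2.
    apply: ler_pM => //; first exact: C_le_bound.
    exact: le_trans (expRN_lipschitz (tau'0 y) (tau'le y)) (taule y).
  apply: (@le_trans _ _ 0); last by rewrite mulr_ge0 ?sqr_ge0 // divr_ge0 // ltW.
  by rewrite subr_le0 ler_expR lerN2.
(* The function [expR (- x) * (1 + x)] decreases for [x >= 0], so the capping costs nothing on the
   demand side. *)
have psi y : expR (- tau y) * (1 + tau y) <= expR (- tau' y) * (1 + tau' y).
  have -> : expR (- tau' y) = expR (- tau y) * expR (tau y - tau' y).
    by rewrite -expRD; congr expR; ring.
  rewrite -mulrA ler_wpM2l ?expR_ge0 //.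
  have := expR_ge1Dx (tau y - tau' y); have := tau'le y; have := tau'0 y.
  move: (expR _) => e; nra.
have MtE : (fun y => M y * t y) = tau' by apply/funext => y; exact: Mt.
have supply : \sum_i expR (- (n%:R * \sum_y q y * (a i y * expR (- tau y)))) <=
    n%:R * (\sum_x p x * supply_free_prob tau' x) + dev + c ^+ 2 * dev.
  apply: (@le_trans _ _ (\sum_i (supply_free_prob tau' (u i) + c ^+ 2 * (dev / n%:R)))).
    apply: ler_sum => i _; apply: le_trans (free (u i)); rewrite le_eqVlt; apply/orP; left.
    apply/eqP; rewrite -supply_rate_E; congr (expR (- (_ * _))).
    by apply: eq_bigr => y _; rewrite mulrA mulrAC.
  rewrite big_split /= sumr_const card_ord -[c ^+ 2 * _ *+ _]mulr_natr.
  rewrite -[c ^+ 2 * (dev / _) * _]mulrA divfK ?lt0r_neq0 // lerD2r -lerBlDl.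
  have := sum_types_le u (phi := supply_free_prob tau') (B := 1).
  rewrite mulr1 => /(_ _)/ler_normlW; apply => x; exact: supply_free_prob01.
have demand : n%:R * (\sum_y q y * (1 - expR (- tau' y) * (1 + tau' y))) <=
    n%:R * (1 - \sum_y q y * (expR (- tau y) * (1 + tau y))).
  rewrite ler_wpM2l ?(ltW n0) //.
  have -> : 1 - \sum_y q y * (expR (- tau y) * (1 + tau y)) =
      \sum_y q y * (1 - expR (- tau y) * (1 + tau y)).
    by under [RHS]eq_bigr do rewrite mulrBr mulr1; rewrite sumrB (proj2 q_law).
  apply: ler_sum => y _; apply: ler_wpM2l; first exact: (proj1 q_law).
  by rewrite lerD2l lerN2.
have := hm t t01; have := matching_F_free t; rewrite MtE.
under [X in _ = _ + X -> _]eq_bigr do rewrite Mt.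
have -> : \sum_x p x * (1 - supply_free_prob tau' x) = 1 - \sum_x p x * supply_free_prob tau' x.
  under eq_bigr do rewrite mulrBr mulr1.
  by rewrite sumrB (proj2 (is_law_type_prob hbL)).
move=> FE Fm; have : n%:R * (1 - m) <= n%:R * (1 - F t) by rewrite ler_wpM2l ?(ltW n0) //; lra.
rewrite FE mulrDr /cover_profile card_ord.
move: supply demand; lra.
Qed.

Lemma mean_rank_lower (m delta : R) (k0 B : nat) :
  (forall t : 'I_2 -> R, (forall y, 0 <= t y <= 1) -> F t <= m) ->
  0 < delta -> delta <= expR (- c) - c ^+ 2 / n%:R ->
  (0 < k0)%N -> (0 < B)%N -> (k0 * B <= n)%N ->
  n%:R * (1 - m) - (1 + c ^+ 2) * dev
  - (c ^+ 3 + n%:R * (2 * c * (c / B%:R + k0%:R^-1)) + 2 * c / delta * (n%:R / B%:R)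
       + (k0 * B)%:R) <= mean_rank.
Proof.
move=> hm d0 dle k00 B0 kB.
have := @rank_mean_ge R 'I_n 'I_2 q a c q_law edge_prob_ge0 edge_prob_le nR bound_gt0 c_le'
   delta (n%:R * (1 - m) - (1 + c ^+ 2) * dev) k0 B d0.
rewrite card_ord; apply => // S; exact: cover_profile_lower.
Qed.

End FixedTypes.

(** * Limit of the mean rank, and existence of the maximum *)

Lemma archimedean_scale (x eta : R) : 0 < eta ->
  exists2 N : nat, (0 < N)%N & forall n, (N <= n)%N -> x <= eta * n%:R.
Proof.
move=> eta0; exists (Num.truncn (x / eta)).+1 => // n Nn.
rewrite -ler_pdivrMl // mulrC; apply: (@le_trans _ _ (Num.truncn (x / eta)).+1%:R).
  by apply/ltW; rewrite truncnS_gt.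
by rewrite ler_nat.
Qed.

Lemma mean_rank_limit (m eta : R) :
  (forall t : 'I_2 -> R, (forall y, 0 <= t y <= 1) -> F t <= m) ->
  (exists2 t : 'I_2 -> R, forall y, 0 <= t y <= 1 & F t = m) -> 0 < eta ->
  exists2 delta : R, 0 < delta & exists N : nat, forall n, (N <= n)%N ->
    [/\ (0 < n)%N, c <= n%:R & forall u : 'I_n -> 'I_2,
     `|flexible_count u - n%:R * bL| <= delta * n%:R ->
     `|iid_mean (set_law q (edge_prob u)) n (fun H => (rank H)%:R) - n%:R * (1 - m)|
       <= eta * n%:R].
Proof.
move=> hm [t0 t01 Ft0] eta0.
have c0 := bound_gt0; have c0' := ltW c0.
have c2 : 0 <= c ^+ 2 by exact: sqr_ge0.
have e4 : 0 < eta / 4 by rewrite divr_gt0.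
have e8 : 0 < eta / 8 by rewrite divr_gt0.
(* Half of [expR (- c)] is below [expR (- c) - c ^+ 2 / n] as soon as [c ^+ 2 <= d * n]. *)
pose d := expR (- c) / 2; have d0 : 0 < d by rewrite divr_gt0 ?expR_gt0.
pose delta := eta / 4 / (1 + c ^+ 2).
have delta0 : 0 < delta by rewrite divr_gt0 //; lra.
have delta_eta : (1 + c ^+ 2) * delta = eta / 4.
  by rewrite mulrC divfK //; apply: lt0r_neq0; lra.
have delta_le : delta <= eta / 4 by have := ltW delta0; nra.
(* Both [k0] and [B] depend on [eta] and [c] only, so the constants [c ^+ 3] and [k0 * B] fall below
   [eta / 4 * n] for large [n]. *)
have [k0 k00 hk0] := archimedean_scale (2 * c) e8.
have [B B0 hB] := archimedean_scale (2 * c ^+ 2 + 2 * c / d) e8.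
have [N1 _ hN1] := archimedean_scale (2 * c ^+ 2 + eta^-1) e4.
have [N2 _ hN2] := archimedean_scale (c ^+ 3 + (k0 * B)%:R) e4.
have [N3 N30 hN3] := archimedean_scale (c ^+ 2) d0.
have [N4 _ hN4] := archimedean_scale c ltr01.
exists delta => //; exists (maxn N1 (maxn N2 (maxn N3 (maxn N4 (k0 * B))))) => n.
rewrite !geq_max => /and5P[Nn1 Nn2 Nn3 Nn4 kB].
have n0 : (0 < n)%N by exact: leq_trans Nn3.
have nR : 0 < n%:R :> R by rewrite ltr0n.
have {}hN1 : 2 * c ^+ 2 + eta^-1 <= eta / 4 * n%:R.
  by exact: hN1.
have {}hN2 : c ^+ 3 + (k0 * B)%:R <= eta / 4 * n%:R.
  by exact: hN2.
have {}hN3 : c ^+ 2 <= d * n%:R.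
  by exact: hN3.
have cn : c <= n%:R.
  rewrite -[leRHS]mul1r; exact: hN4.
split=> // u hdev; set mean := iid_mean _ _ _.
rewrite ler_norml; apply/andP; split; last first.
  (* With [s = eta / 2 * n] the error [s / 2 + n / (2 * s)] becomes [eta / 4 * n + 1 / eta]. *)
  have s0 : 0 < eta / 2 * n%:R by rewrite mulr_gt0 // divr_gt0.
  have := mean_rank_upper u n0 cn (fun y => proj1 (andP (t01 y))) s0.
  rewrite -/mean Ft0.
  have -> : n%:R / (2 * (eta / 2 * n%:R)) = eta^-1.
    by field; rewrite !lt0r_neq0.
  have : delta * n%:R <= eta / 4 * n%:R by rewrite ler_wpM2r // ltW.
  move: hdev hN1; move: `|_| => dev; lra.
have dle : d <= expR (- c) - c ^+ 2 / n%:R.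
  have : c ^+ 2 / n%:R <= d by rewrite ler_pdivrMr.
  by rewrite /d; lra.
have := mean_rank_lower u n0 cn hm d0 dle k00 B0 kB.
have k0R : 0 < k0%:R :> R by rewrite ltr0n.
have BR : 0 < B%:R :> R by rewrite ltr0n.
have hk : 2 * c / k0%:R <= eta / 8 by rewrite ler_pdivrMr // hk0.
have hBB : (2 * c ^+ 2 + 2 * c / d) / B%:R <= eta / 8 by rewrite ler_pdivrMr // hB.
have dev_le : (1 + c ^+ 2) * `|flexible_count u - n%:R * bL| <= eta / 4 * n%:R.
  rewrite -delta_eta -mulrA ler_wpM2l //; lra.
have hkn : n%:R * (2 * c / k0%:R) <= n%:R * (eta / 8) by rewrite ler_wpM2l // ltW.
have hBn : n%:R * ((2 * c ^+ 2 + 2 * c / d) / B%:R) <= n%:R * (eta / 8).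
  by rewrite ler_wpM2l // ltW.
have en : 0 <= eta * n%:R by rewrite mulr_ge0 // ltW.
rewrite -/mean; move: dev_le hN2 hkn hBn en.
by move: mean `|_| => mean dev; lra.
Qed.

Lemma continuous_bigsum (T : topologicalType) (I : Type) (r : seq I) (f : I -> T -> R) (v : T) :
  (forall i, {for v, continuous (f i)}) ->
  {for v, continuous (fun w => \sum_(i <- r) f i w)}.
Proof.
move=> cf; elim: r => [|i r IH].
  rewrite (_ : (fun w => _) = cst 0); first exact: cst_continuous.
  by apply/funext => w; rewrite big_nil.
rewrite (_ : (fun w => _) = f i \+ (fun w => \sum_(j <- r) f j w)).
  by apply: continuousD; [exact: cf | exact: IH].
by apply/funext => w; rewrite big_cons.
Qed.

Lemma matching_F_maximum : exists2 m,
  (forall t : 'I_2 -> R, (forall y, 0 <= t y <= 1) -> F t <= m) &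
  (exists2 t : 'I_2 -> R, forall y, 0 <= t y <= 1 & F t = m).
Proof.
(* Functions on ['I_2] are encoded as row vectors, whose unit cube is compact, so that the extreme
   value theorem applies. *)
pose G (v : 'rV[R]_2) := F (fun y => v ord0 y).
pose A := [set v : 'rV[R]_2 | forall y, `[0, 1]%classic (v ord0 y)]%classic.
have A0 : (A !=set0)%classic.
  by exists (const_mx 0) => y /=; rewrite mxE in_itv /= lexx ler01.
have cA : compact A.
  by apply: (@rV_compact R 2 (fun=> `[0, 1]%classic)) => y; exact: segment_compact.
have cG : {within A, continuous G}.
  apply: continuous_subspaceT => v; rewrite /G /F /matching_F -/p -/q -/M /=.
  have cD (f g : 'rV[R]_2 -> R) : {for v, continuous f} -> {for v, continuous g} ->
      {for v, continuous (fun w => f w + g w)} by exact: continuousD.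
  have cc (k : R) : {for v, continuous (fun=> k : R)} by exact: cst_continuous.
  have cv y : {for v, continuous (fun w : 'rV[R]_2 => M y * w ord0 y)}.
    by apply: continuousM; [exact: cc | exact: coord_continuous].
  have ce y : {for v, continuous (fun w : 'rV[R]_2 => expR (- (M y * w ord0 y)))}.
    apply: (@continuous_comp _ _ _ (fun w : 'rV[R]_2 => - (M y * w ord0 y)) expR); last exact: continuous_expR.
    by apply: continuousN; exact: cv.
  apply: (cD); last exact: cc.
  apply: (cD); apply: continuous_bigsum => x.
    apply: continuousM; first exact: cc.
    apply: (@continuous_comp _ _ _ (fun w : 'rV[R]_2 =>
      - \sum_(y < 2) C x y * q y * expR (- (M y * w ord0 y))) expR); last exact: continuous_expR.
    apply: continuousN; apply: continuous_bigsum => y.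
    by apply: continuousM; [exact: cc | exact: ce].
  apply: continuousM; last by apply: (cD); [exact: cc | exact: cv].
  by apply: continuousM; [exact: cc | exact: ce].
have [v vA hv] := EVT_max_rV A0 cA cG.
have v01 y : 0 <= v ord0 y <= 1.
  by have := set_mem vA y; rewrite /= in_itv.
exists (G v); last by exists (fun y => v ord0 y).
move=> t t01; have -> : F t = G (\row_y t y).
  by congr F; apply/funext => y; rewrite mxE.
by apply: hv; apply: mem_set => y; rewrite /= in_itv mxE /= t01.
Qed.

(** * Law of the graph and concentration *)

Lemma graph_mean n (u : node_types n) (f : seq {set 'I_n} -> R) :
  \sum_(v : node_types n) \sum_(E : bip_graph n)
    (\prod_(j < n) q (v j)) * edges_law C u v E * f (columns E) =
  iid_mean (set_law q (edge_prob u)) n f.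
Proof.
rewrite iid_mean_ffun exchange_big /=.
(* A graph is the family of its neighbourhoods. Given the supply types these are independent, and
   expanding the product of the mixtures recovers the sum over demand types. *)
rewrite [RHS](reindex (fun E : bip_graph n => [ffun j => neighbours E j])) /=; last first.
  exists (fun w : {ffun 'I_n -> {set 'I_n}} => [set e | e.1 \in w e.2]%SET) => [E|w] _.
    by apply/setP => -[i j]; rewrite inE ffunE inE.
  by apply/ffunP => j; apply/setP => i; rewrite ffunE !inE.
apply: eq_bigr => E _; rewrite -mulr_suml; congr (_ * f _); last first.
  by apply: eq_map => j; rewrite ffunE.
under [RHS]eq_bigr do rewrite ffunE /set_law.
rewrite bigA_distr_bigA /=; apply: eq_bigr => v _.
rewrite big_split /=; congr (_ * _); rewrite /edges_law exchange_big /=.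
apply: eq_bigr => j _; apply: eq_bigr => i _.
by rewrite inE.
Qed.

Lemma is_law_edges n (u : 'I_n -> 'I_2) : (0 < n)%N -> c <= n%:R ->
  is_law (set_law q (edge_prob u)).
Proof.
move=> n0 cn; apply: is_law_set_law => // i y.
rewrite divr_ge0 //= ler_pdivrMr ?ltr0n // mul1r; exact: le_trans (C_le_bound _ _) cn.
Qed.

Lemma rank_lipschitz n (H1 : seq {set 'I_n}) N N' H2 :
  `|(rank (H1 ++ N :: H2))%:R - (rank (H1 ++ N' :: H2))%:R| <= 1 :> R.
Proof.
have /andP[a1 a2] := rank_cat_cons H1 N H2; have /andP[b1 b2] := rank_cat_cons H1 N' H2.
move: a1 a2 b1 b2; rewrite -!(ler_nat R) -natr1 ler_norml => *; apply/andP; split; lra.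
Qed.

Lemma flexible_concentration n (delta : R) : 0 < delta -> (0 < n)%N ->
  \sum_(u : node_types n) (\prod_i p (u i)) *
     (delta * n%:R <= `|flexible_count u - n%:R * bL|)%R%:R <= (delta ^+ 2 * n%:R)^-1.
Proof.
move=> d0 n0; have nR : 0 < n%:R :> R by rewrite ltr0n.
have p_law := is_law_type_prob hbL.
pose f (K : seq 'I_2) : R := \sum_(x <- K) (x != ord0)%:R.
have mean_f : iid_mean p n f = n%:R * bL.
  rewrite /f iid_mean_additive // mean_type_prob eqxx /=; ring.
have := @chebyshev_iid_mean R _ p p_law n f (delta * n%:R) (mulr_gt0 d0 nR).
rewrite mean_f iid_mean_ffun => h.
have {h} := h _; have -> : n%:R / (delta * n%:R) ^+ 2 = (delta ^+ 2 * n%:R)^-1.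
  by field; rewrite !lt0r_neq0.
move=> h; apply: le_trans (h _) => [|H1 x y H2].
  apply: ler_sum => u _; rewrite /f big_map big_enum /=.
  by rewrite -/(flexible_count u).
rewrite /f !big_cat !big_cons /= opprD addrACA subrr add0r opprD addrACA subrr addr0.
by case: (x != _); case: (y != _); rewrite ?subrr ?subr0 ?sub0r ?normrN ?normr0 ?normr1.
Qed.

(** This conditions on the supply types. They are atypical with probability O(1/n). Otherwise the
    conditional mean, divided by [n], is within [eps / 2] of the limit; as one demand changes the
    rank by at most 1, Chebyshev's inequality bounds the remaining fluctuation by another O(1/n). *)
Lemma matching_tail (m eps : R) :
  (forall t : 'I_2 -> R, (forall y, 0 <= t y <= 1) -> F t <= m) ->
  (exists2 t : 'I_2 -> R, forall y, 0 <= t y <= 1 & F t = m) -> 0 < eps ->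
  exists2 K : R, 0 <= K & exists N : nat, forall n, (N <= n)%N ->
    [/\ (0 < n)%N, c <= n%:R &
     \sum_(u : node_types n) \sum_(v : node_types n) \sum_(E : bip_graph n)
       types_law bL bR u v * edges_law C u v E *
       (eps < `|(max_matching E)%:R / n%:R - (1 - m)|)%R%:R <= K / n%:R].
Proof.
move=> hm hex eps0; have e2 : 0 < eps / 2 by rewrite divr_gt0.
have [delta d0 [N hN]] := mean_rank_limit hm hex e2.
exists ((delta ^+ 2)^-1 + ((eps / 2) ^+ 2)^-1).
  by rewrite addr_ge0 // invr_ge0 sqr_ge0.
exists N => n Nn; have [n0 cn hu] := hN n Nn; split=> //.
have nR : 0 < n%:R :> R by rewrite ltr0n.
pose bad (H : seq {set 'I_n}) : R := (eps < `|(rank H)%:R / n%:R - (1 - m)|)%R%:R.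
have [p_ge0 p_sum] := is_law_type_prob hbL.
have -> : \sum_(u : node_types n) \sum_(v : node_types n) \sum_(E : bip_graph n)
       types_law bL bR u v * edges_law C u v E *
       (eps < `|(max_matching E)%:R / n%:R - (1 - m)|)%R%:R =
  \sum_(u : node_types n) (\prod_i p (u i)) * iid_mean (set_law q (edge_prob u)) n bad.
  apply: eq_bigr => u _; rewrite -graph_mean mulr_sumr; apply: eq_bigr => v _.
  rewrite mulr_sumr; apply: eq_bigr => E _.
  by rewrite /types_law /bad max_matchingE !mulrA.
have bound (u : node_types n) : iid_mean (set_law q (edge_prob u)) n bad <=
    (delta * n%:R <= `|flexible_count u - n%:R * bL|)%R%:R + ((eps / 2) ^+ 2 * n%:R)^-1.
  have law := is_law_edges u n0 cn.
  have inv0 : 0 <= ((eps / 2) ^+ 2 * n%:R)^-1 by rewrite invr_ge0 mulr_ge0 ?sqr_ge0 ?ltW.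
  case: (leP (delta * n%:R)) => [_|/ltW hgood]; last have hmean := hu u hgood.
    apply: (@le_trans _ _ 1); last by rewrite lerDl.
    rewrite -[leRHS](iid_mean_cst law n); apply: ler_iid_mean => // H _.
    by rewrite /bad lern1 leq_b1.
  rewrite add0r.
  have := @chebyshev_iid_mean R _ _ law n (fun H => (rank H)%:R) (eps / 2 * n%:R)
    (mulr_gt0 e2 nR) (@rank_lipschitz n).
  have -> : n%:R / (eps / 2 * n%:R) ^+ 2 = ((eps / 2) ^+ 2 * n%:R)^-1.
    by field; rewrite !lt0r_neq0.
  apply: le_trans; apply: ler_iid_mean => // H _; rewrite /bad.
  case: (ltP eps) => // heps; case: (leP (eps / 2 * n%:R)) => // hlt; exfalso.
  move: hmean hlt heps; set mu := iid_mean _ _ _ => hmean hlt.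
  have -> : (rank H)%:R / n%:R - (1 - m) = ((rank H)%:R - n%:R * (1 - m)) / n%:R.
    by field; rewrite lt0r_neq0.
  rewrite normrM normfV [X in _ / X]ger0_norm ?(ltW nR) // ltr_pdivlMr //.
  rewrite ltNge => /negP; apply.
  have -> : (rank H)%:R - n%:R * (1 - m) = ((rank H)%:R - mu) + (mu - n%:R * (1 - m)) by ring.
  apply: le_trans (ler_normD _ _) _.
  by move: hmean hlt => /=; lra.
apply: (@le_trans _ _ (\sum_(u : node_types n) (\prod_i p (u i)) *
   ((delta * n%:R <= `|flexible_count u - n%:R * bL|)%R%:R + ((eps / 2) ^+ 2 * n%:R)^-1))).
  by apply: ler_sum => u _; rewrite ler_wpM2l // prodr_ge0.
under eq_bigr do rewrite mulrDr.
rewrite big_split /= mulrDl; apply: lerD.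
  by rewrite -invfM; exact: flexible_concentration.
rewrite -mulr_suml -(bigA_distr_bigA (fun _ : 'I_n => p)) /= big1 ?mul1r ?invfM //.
Qed.

End CompatibilityGraph.

(** * Transfer to the given probability spaces *)

Local Open Scope classical_set_scope.
Local Open Scope ring_scope.

Lemma finite_union_le (R : realType) d (T : measurableType d) (P : probability T R)
    (X : choiceType) (r : seq X) (Q : pred X) (A : X -> set T) :
  (forall x, measurable (A x)) ->
  (P (\bigcup_(x in [set x | (x \in r) && Q x]) A x) <= \sum_(x <- r | Q x) P (A x))%E.
Proof.
move=> mA; rewrite bigcup_seq_cond.
elim: r => [|x r IH]; first by rewrite !big_nil measure0.
rewrite !big_cons; case: ifP => // _; apply: le_trans (measureU2 _ _ _) _ => //.
  exact: bigsetU_measurable.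
exact: leeD.
Qed.

(** The event is a finite union of atoms of prescribed probability, to which subadditivity
    applies. *)
Lemma graph_event_le (R : realType) (bL bR : R) (C : 'M[R]_2) n d
    (T : measurableType d) (P : probability T R)
    (U V : T -> node_types n) (G : T -> bip_graph n) (Q : pred (bip_graph n)) :
  is_compatibility_graph bL bR C P U V G ->
  (P [set w | Q (G w)] <= (\sum_(u : node_types n) \sum_(v : node_types n)
     \sum_(E : bip_graph n) types_law bL bR u v * edges_law C u v E * (Q E)%:R)%:E)%E.
Proof.
move=> hP.
pose A (x : node_types n * node_types n * bip_graph n) : set T :=
  [set w | [/\ U w = x.1.1, V w = x.1.2 & G w = x.2]].
have mA x : measurable (A x) by case: (hP x.1.1 x.1.2 x.2).
have -> : [set w | Q (G w)] =
    \bigcup_(x in [set x | (x \in index_enum _) && Q x.2]) A x.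
  apply/seteqP; split => [w /= Qw|w [x /=]].
    by exists (U w, V w, G w) => //=; rewrite mem_index_enum.
  by rewrite mem_index_enum /= => Qx [_ _ ->].
apply: le_trans (finite_union_le P (index_enum _) (fun x => Q x.2) mA) _.
under eq_bigr => x _ do rewrite (proj2 (hP x.1.1 x.1.2 x.2)).
rewrite sumEFin lee_fin.
rewrite pair_bigA /= pair_bigA /= [leLHS]big_mkcond /=.
rewrite le_eqVlt; apply/orP; left; apply/eqP; apply: eq_bigr => -[[u v] E] _ /=.
by case: (Q E); rewrite ?mulr1 ?mulr0.
Qed.

Theorem theorem1 (R : realType) (bL bR : R) (C : 'M[R]_2)
    (d : nat -> measure_display) (T : forall n, measurableType (d n))
    (P : forall n, probability (T n) R)
    (U V : forall n, T n -> node_types n) (G : forall n, T n -> bip_graph n)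
    (hbL : 0 <= bL <= 1) (hbR : 0 <= bR <= 1)
    (hC : forall x y, 0 <= C x y)
    (hG : forall n, (forall x y, C x y / n%:R <= 1) ->
            is_compatibility_graph bL bR C (P n) (U n) (V n) (G n)) :
  exists2 m : R,
    is_maximum [set matching_F bL bR C t | t in [set t | forall y, 0 <= t y <= 1]] m &
    cvg_in_probability_to P (fun n w => (max_matching (G n w))%:R / n%:R) (1 - m).
Proof.
have [m hm [t t01 Ft]] := matching_F_maximum bL bR C.
exists m.
  split; first by exists t.
  by move=> _ [s /= s01 <-]; exact: hm.
move=> eps eps0.
have hex : exists2 t, forall y, 0 <= t y <= 1 & matching_F bL bR C t = m by exists t.
have [K K0 [N hN]] := matching_tail hbL hbR hC hm hex eps0.
(* Since [harmonic n] is [1 / (n + 1)], the bound [K / n] is replaced by [2 K / (n + 1)], which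
   dominates it for [n >= 1]. *)
apply: (@squeeze_cvge _ _ _ _ (cst 0%E) _ (fun n => ((2 * K) * harmonic n)%:E)).
- exists N => // n /= /hN[n0 cn hK].
  have Cn x y : C x y / n%:R <= 1.
    by rewrite ler_pdivrMr ?ltr0n // mul1r (le_trans _ cn) // C_le_bound.
  have := graph_event_le (P := P n)
    (fun E : bip_graph n => eps < `|(max_matching E)%:R / n%:R - (1 - m)|) (hG n Cn).
  move=> event_le; apply/andP; split; first exact: measure_ge0.
  apply: le_trans event_le _; rewrite lee_fin; apply: le_trans hK _ => /=.
  have nR : 1 <= n%:R :> R by rewrite ler1n.
  rewrite ler_pdivlMr ?ltr0n // mulrAC ler_pdivrMr ?ltr0n // -natr1.
  by have := K0; move: (n%:R) nR => x; nra.
- exact: cvg_cst.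
- have -> : (0%E : \bar R) = ((2 * K) * 0)%:E by rewrite mulr0.
  apply: cvg_EFin; first exact: nearW.
  by apply: cvgMr; exact: cvg_harmonic.
Qed.
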